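(* Let $\Omega\subset\mathbb{R}^n$ be an open convex set with finite inradius $\delta_0=\delta_0(\Omega)$. Let $m>1$, $f\in C_0^1(\Omega)$ and $|\nabla f|/\delta\in L^1(\Omega)$. If $\nu\in(0,1/m]$ and $\lambda\in\left[0,\frac{1+\nu m}{2}\right)$, then $$\frac{1-\nu^2m^2}{4}\int_\Omega\frac{|f(x)|}{\delta(x)^2}\,dx+\frac{c_\nu^2(m)+(m-1)(\lambda-\lambda^2)}{\delta_0^m}\int_\Omega\frac{|f(x)|}{\delta(x)^{2-m}}\,dx\le\left(\frac{1+\nu m}{2}-\lambda^2\right)\int_\Omega\frac{|\nabla f(x)|}{\delta(x)}\,dx,$$ where $c_\nu(m)$ (which depends on $\lambda$) is the number satisfying $$(1-2\lambda)J_\nu\left(\tfrac{2}{m}c_\nu(m)\right)+2c_\nu(m)J_\nu'\left(\tfrac{2}{m}c_\nu(m)\right)=0\quad\text{and}\quad \tfrac{2}{m}c_\nu(m)\in(0,j_\nu).$$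
   Context: $J_\nu$ is the Bessel function of the first kind of order $\nu$, $J_\nu'$ its derivative, and $j_\nu$ the first positive zero of $J_\nu$; $c_\nu(m)$ is taken to be the first such root. For an open set $\Omega$, $\delta(x)=\operatorname{dist}(x,\partial\Omega)$ and the inradius is $\delta_0(\Omega)=\sup_{x\in\Omega}\delta(x)$. $C_0^1(\Omega)$ is the family of continuously differentiable functions $\Omega\to\mathbb{R}$ with compact support in $\Omega$. *)

(* Defs.v *)
(* R^n is 'rV[R]_n over an arbitrary R : realType. *)
From HB Require Import structures.
From mathcomp Require Import all_boot all_order all_algebra.
From mathcomp Require Import all_classical all_reals all_analysis.

Set Implicit Arguments.
Unset Strict Implicit.
Unset Printing Implicit Defensive.

Import Order.TTheory GRing.Theory Num.Theory.
Import numFieldNormedType.Exports.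

Local Open Scope classical_set_scope.
Local Open Scope ring_scope.

Definition rV_display : measure_display -> measure_display.
Proof. exact. Qed.

(* The sigma-algebra generated by the coordinates, i.e. the product (= Borel)
   sigma-algebra of R^n. *)
Section measurable_rV.
Context {d} {T : sigmaRingType d}.
Variable n : nat.

Let coors : 'I_n -> 'rV[T]_n -> T := fun i x => x ord0 i.

Let rV_set0 : g_sigma_preimage coors set0.
Proof. exact: sigma_algebra0. Qed.

Let rV_setC A : g_sigma_preimage coors A -> g_sigma_preimage coors (~` A).
Proof. exact: sigma_algebraC. Qed.

Let rV_bigcup (F : _^nat) : (forall i, g_sigma_preimage coors (F i)) ->
  g_sigma_preimage coors (\bigcup_i (F i)).
Proof. exact: sigma_algebra_bigcup. Qed.

HB.instance Definition _ := @isMeasurable.Build (rV_display d)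
  'rV[T]_n (g_sigma_preimage coors) rV_set0 rV_setC rV_bigcup.

End measurable_rV.

Lemma measurable_fun_rVP d1 d2 (T1 : measurableType d1)
    (T2 : sigmaRingType d2) n (f : T1 -> 'rV[T2]_n) :
  measurable_fun [set: T1] f <->
  forall i, measurable_fun [set: T1] (fun x => f x ord0 i).
Proof.
have bigE : \big[setU/set0]_(i < n) preimage_set_system setT
    (fun x : 'rV[T2]_n => x ord0 i) measurable =
    [set B | exists i : 'I_n, exists2 A, measurable A &
      B = (fun x : 'rV[T2]_n => x ord0 i) @^-1` A].
  rewrite -bigcup_seq; apply/seteqP; split=> B /=.
    by move=> [i _ [A mA <-]]; exists i, A => //; rewrite setTI.
  move=> [i [A mA ->]]; exists i => /=; first by rewrite mem_index_enum.
  by exists A => //; rewrite setTI.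
split=> [mf i _ A mA|mf].
  rewrite setTI.
  have := mf measurableT ((fun x : 'rV[T2]_n => x ord0 i) @^-1` A).
  rewrite setTI; apply; apply: sub_sigma_algebra; rewrite bigE.
  by exists i, A.
apply: (@measurability _ _ _ _ setT f (\big[setU/set0]_(i < n)
  preimage_set_system setT (fun x : 'rV[T2]_n => x ord0 i) measurable)) => //.
rewrite bigE.
move=> _ [_ [i [A mA ->]] <-].
exact: (mf i measurableT A mA).
Qed.

Section lebesgue_measure_rV.
Context {R : realType}.

Definition rV_cons n (p : R * 'rV[R]_n) : 'rV[R]_n.+1 :=
  row_mx (const_mx p.1 : 'rV[R]_1) p.2.

Lemma rV_cons0 n (p : R * 'rV[R]_n) : rV_cons p ord0 ord0 = p.1.
Proof.
rewrite (_ : ord0 = lshift n (ord0 : 'I_1)); last exact: val_inj.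
by apply: etrans (row_mxEl _ _ _ _) _; rewrite mxE.
Qed.

Lemma rV_consS n (p : R * 'rV[R]_n) i : rV_cons p ord0 (lift ord0 i) = p.2 ord0 i.
Proof.
rewrite (_ : lift ord0 i = rshift 1 i); last exact: val_inj.
exact: row_mxEr.
Qed.

Lemma measurable_rV_cons n :
  measurable_fun [set: measurableTypeR R * 'rV[measurableTypeR R]_n]
    (@rV_cons n : _ -> 'rV[measurableTypeR R]_n.+1).
Proof.
apply/measurable_fun_rVP => i.
have mid := @measurable_id _ 'rV[measurableTypeR R]_n setT.
case: (unliftP ord0 i) => [j|] ->.
- rewrite [X in measurable_fun _ X](_ : _ =
    (fun x : 'rV[measurableTypeR R]_n => x ord0 j) \o snd).
    by apply: measurableT_comp => //; move/measurable_fun_rVP : mid; exact.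
  by apply/funext => p; exact: rV_consS.
- rewrite [X in measurable_fun _ X](_ : _ = fst); first exact: measurable_fst.
  by apply/funext => p; exact: rV_cons0.
Qed.

(* n-dimensional Lebesgue measure: the Dirac mass on R^0, then the image of
   (Lebesgue on R) x (Lebesgue on R^n) under R * R^n ~ R^n.+1. *)
Fixpoint lebesgue_measure_rV n :
    {measure set 'rV[measurableTypeR R]_n -> \bar R} :=
  match n return {measure set 'rV[measurableTypeR R]_n -> \bar R} with
  | 0%N => [the {measure set _ -> \bar R} of
             \d_ (0 : 'rV[measurableTypeR R]_0)]
  | n'.+1 =>
      measure_function_pushforward__canonical__measure_function_Measure
        (@lebesgue_measure R \x^ lebesgue_measure_rV n')%E
        (@measurable_rV_cons n')
  end.

End lebesgue_measure_rV.

Lemma lebesgue_measure_rV_box {R : realType} n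
    (A : 'I_n -> set (measurableTypeR R)) :
  (forall i, measurable (A i)) ->
  lebesgue_measure_rV n [set x | forall i, A i (x ord0 i)] =
  (\prod_(i < n) @lebesgue_measure R (A i))%E.
Proof.
elim: n A => [|n IH] A mA.
  rewrite big_ord0 /= diracE mem_set//= => i; by case: i.
rewrite big_ord_recl /= /pushforward.
rewrite (_ : _ @^-1` _ = A ord0 `*`
    [set x : 'rV[measurableTypeR R]_n | forall i, A (lift ord0 i) (x ord0 i)]).
  rewrite product_measure2E//; first by congr (_ * _)%E; exact: IH.
  rewrite (_ : mkset _ = \big[setI/setT]_(i < n)
     ((fun x : 'rV[measurableTypeR R]_n => x ord0 i) @^-1` A (lift ord0 i))).
    apply: bigsetI_measurable => i _; rewrite -[X in measurable X]setTI.
    have /measurable_fun_rVP/(_ i) := @measurable_id _ 'rV[measurableTypeR R]_n setT.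
    exact.
  by apply/seteqP; split=> x /=; rewrite -bigcap_seq => h i; [move=> _|]; apply: h => /=; rewrite mem_index_enum.
apply/seteqP; split=> -[a x] /= => [Aax|[Aa Ax] i].
  split; first by have := Aax ord0; rewrite rV_cons0.
  by move=> i; have := Aax (lift ord0 i); rewrite rV_consS.
by case: (unliftP ord0 i) => [j|] ->; [rewrite rV_consS|rewrite rV_cons0].
Qed.

Section euclidean.
Context {R : realType} {n : nat}.
Implicit Types (x y : 'rV[R]_n) (Omega : set 'rV[R]_n) (f : 'rV[R]_n -> R).

(* The library norm on 'rV[R]_n is the sup norm. *)
Definition enorm x : R := Num.sqrt (\sum_(i < n) x ord0 i ^+ 2).

Definition boundary Omega : set 'rV[R]_n := closure Omega `\` interior Omega.

(* Extended-real valued, so that the distance to an empty boundary is +oo. *)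
Definition delta Omega x : \bar R :=
  ereal_inf [set (enorm (x - y))%:E | y in boundary Omega].

Definition inradius Omega : \bar R :=
  ereal_sup [set delta Omega x | x in Omega].

Definition grad f x : 'rV[R]_n := \row_i 'D_(delta_mx ord0 i) f x.

(* f is a total function, of which only the values on Omega matter. *)
Definition C1_compact Omega f :=
  [/\ forall x, Omega x -> differentiable f x,
      forall x, Omega x -> {for x, continuous (grad f)} &
      let supp := closure [set x | Omega x /\ f x != 0] in
      compact supp /\ supp `<=` Omega].

End euclidean.

Section bessel.
Context {R : realType}.
Implicit Types nu m lam x c : R.

(* Meaningful for 0 < s only: otherwise the integral is infinite. *)
Definition Gamma (s : R) : R :=
  \int[@lebesgue_measure R]_(t in `]0, +oo[) (t `^ (s - 1) * expR (- t)).

(* The Bessel function J_nu on the positive half-line, for nu >= 0 real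
   (the real power `^ is not the intended one for x < 0). *)
Definition besselJ nu x : R :=
  limn (series (fun k : nat =>
    (-1) ^+ k / (k`!%:R * Gamma (k%:R + nu + 1)) *
    (x / 2) `^ (2 * k%:R + nu))).

(* The least element of A, with value 0 if there is none. *)
Definition least (A : set R) : R := xget 0 (A `&` lbound A).

Lemma leastP (A : set R) a : A a -> lbound A a -> least A = a.
Proof.
move=> Aa la; apply: xget_unique => // b [Ab lb].
by apply/eqP; rewrite eq_le lb//= la.
Qed.

Definition bessel_zero nu : R := least [set x | 0 < x /\ besselJ nu x = 0].

Definition bessel_c lam nu m : R :=
  least [set c | 0 < 2 / m * c < bessel_zero nu /\
    (1 - 2 * lam) * besselJ nu (2 / m * c) +
    2 * c * derive1 (besselJ nu) (2 / m * c) = 0].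

End bessel.

(* Main.v *)
Require Import Defs.
From mathcomp Require Import all_boot all_order all_algebra.
From mathcomp Require Import all_classical all_reals all_analysis.
From mathcomp Require Import measurable_realfun.
From mathcomp Require Import ring lra.

Set Implicit Arguments.
Unset Strict Implicit.
Unset Printing Implicit Defensive.

Import Order.TTheory GRing.Theory Num.Theory.
Import numFieldNormedType.Exports.

Local Open Scope classical_set_scope.
Local Open Scope ring_scope.

(** Only one fact about the geometry of the domain is used. At a point x of an
open convex set, a nearest boundary point y gives a unit vector p = (x - y) / |x
- y| such that the whole domain lies in the half-space where p . (z - y) >= 0,
hence delta(z) <= delta(x) + p . (z - x) for every z in the domain, with
equality at x ([dist_supergradient]). In other words delta is concave with
supergradients of norm one.

Let w >= 0 on (0, delta_0], let G' = - w with G >= 0, and let Phi' = G. Formally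
u = Phi(delta) satisfies - Laplacian u >= w(delta) and |grad u| <= G(delta), so
that an integration by parts yields the weighted inequality
  int |f| w(delta) <= int |grad f| G(delta)
([convex_hardy]). Instead of distributional derivatives of delta, the proof uses
difference quotients with step h along the axes. Comparing u with Phi of the
affine majorant of delta gives, at every point, the lower bound of the second
differences by w(delta), and encloses the forward difference quotient of u
between a component of G(delta) p and that component minus h times a second
difference quotient ([local_estimate]). Summation by parts ([discrete_parts])
needs only the translation invariance of Lebesgue measure
([lebesgue_measure_rV_shift]). The error terms have total mass O(h), because the
second differences of u, tested against a Lipschitz cutoff function, are again
summed by parts ([hardy_clamped]).

It remains to choose w(t) = A / t^2 + B / (delta_0^m t^(2 - m)), where A = (1 -
nu^2 m^2) / 4 and B = c^2 + (m - 1)(lambda - lambda^2), and to bound its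
primitive G, which vanishes at delta_0, by (L - lambda^2) / t with L = (1 + nu
m) / 2. With s = t / delta_0 this reads
  B / (m - 1) (s - s^m) <= L^2 - lambda^2 + A s   for 0 < s <= 1
([bessel_c_bound], [weight_tail_le]). To see this, let y(s) = s^(1/2) J_nu((2 c
/ m) s^(m / 2)) and v = s y' / y. Then s v' = v - v^2 - A - c^2 s^m by the
equation of Bessel, v tends to L at 0, and the equation that defines c says that
v(1) = lambda. Since x J_nu'(x) / J_nu(x) decreases up to the first zero of J_nu
([bessel_ratio_nincr]), lambda <= v <= L; replacing v^2 by lambda^2 in the
equation for (v / s)' and integrating from s to 1 gives the claim. The equation
of Bessel is read off the power series, whose coefficients obey their recurrence
because Gamma(s + 1) = s Gamma(s) ([Gamma_recurrence]). *)

(** * The functional equation of the Gamma integral *)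

Section gamma.
Context {R : realType}.
Implicit Types s t b : R.
Notation leb := (@lebesgue_measure R).

Definition gamma_integrand s t : R := t `^ (s - 1) * expR (- t).

Lemma gamma_integrand_ge0 s t : 0 <= gamma_integrand s t.
Proof. by rewrite mulr_ge0 ?powR_ge0 ?expR_ge0. Qed.

Lemma measurable_gamma_integrand s :
  measurable_fun [set: measurableTypeR R] (gamma_integrand s).
Proof.
apply: measurable_funM; first exact: measurable_powR.
by apply: measurableT_comp; [exact: measurable_expR|exact: oppr_measurable].
Qed.

(** The exponential outgrows t^k for a natural k >= s, by its Taylor polynomial
    of degree k + 1. *)
Lemma cvg_powR_expR s : (n%:R `^ s * expR (- n%:R) : R) @[n --> \oo] --> 0.
Proof.
have [k sk] : exists k : nat, s <= k%:R.
  by exists (Num.trunc s).+1; apply/ltW/truncnS_gt.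
apply/cvgrPdist_le => e e0; near=> n.
have n0 : 0 < n%:R :> R by rewrite ltr0n; near: n; exists 1%N.
have n1 : 1 <= n%:R :> R by rewrite -[1]/(1%:R) ler_nat -(ltr0n R).
rewrite sub0r normrN ger0_norm ?mulr_ge0 ?powR_ge0 ?expR_ge0// expRN.
rewrite ler_pdivrMr ?expR_gt0//.
apply: (@le_trans _ _ (n%:R ^+ k)).
  by rewrite -powR_mulrn ?ler0n//; apply: ler_powR.
apply: (@le_trans _ _ (e * (n%:R ^+ k.+1 / k.+1`!%:R))); last first.
  rewrite ler_pM2l//; apply: le_trans (expR_ge1Dxn k (ltW n0)).
  by rewrite lerDr.
rewrite exprS mulrCA -mulrA mulrCA ler_peMr ?exprn_ge0 ?ler0n//.
rewrite mulrA ler_pdivlMr ?ltr0n ?fact_gt0// mul1r mulrC -ler_pdivrMl// mulrC.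
near: n; exact: nbhs_infty_ger.
Unshelve. all: by end_near. Qed.

Lemma powR_cvg0_right s : 0 < s -> t `^ s @[t --> (0 : R)^'+] --> (0 : R) `^ s.
Proof. by move=> s0; rewrite powR0 ?gt_eqF//; exact: powR_cvg0. Qed.

Lemma continuous_powR_pos s t : 0 < t -> {for t, continuous (@powR R ^~ s)}.
Proof.
move=> t0; apply: differentiable_continuous; apply/derivable1_diffP.
by apply: derivable_powR; rewrite in_itv/= t0.
Qed.

Lemma powR_within s b : 0 < s -> 0 < b ->
  {within `[0, b], continuous (@powR R ^~ s)}.
Proof.
move=> s0 b0; apply/continuous_within_itvP => //; split.
- by move=> x; rewrite in_itv/= => /andP[x0 _]; exact: continuous_powR_pos.
- exact: powR_cvg0_right.
- by apply: cvg_at_left_filter; exact: continuous_powR_pos.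
Qed.

Lemma is_derive_expRN t : is_derive t 1 (fun x : R => expR (- x)) (- expR (- t)).
Proof.
have -> : - expR (- t) = expR (- t) * (- 1) by rewrite mulrN1.
by apply: is_derive_eq.
Qed.

Lemma continuous_expRN t : {for t, continuous (fun x : R => expR (- x))}.
Proof.
apply: differentiable_continuous; apply/derivable1_diffP.
by have [] := is_derive_expRN t.
Qed.

(** Integration by parts on [0, b]; s > 1 makes t^(s - 1) continuous at 0 and
    the boundary term there zero. *)
Lemma gamma_parts (s b : R) : 1 < s -> 0 < b ->
  (\int[leb]_(t in `[0%R, b]) (gamma_integrand (s + 1) t)%:E =
   s%:E * \int[leb]_(t in `[0%R, b]) (gamma_integrand s t)%:E
   - (b `^ s * expR (- b))%:E)%E.
Proof.
move=> s1 b0; have s0 : 0 < s := lt_trans ltr01 s1.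
have cE : {within `[0, b], continuous (fun x : R => expR (- x))}.
  by apply: continuous_subspaceT => x; exact: continuous_expRN.
have cP : {within `[0, b], continuous (fun x : R => s * x `^ (s - 1))}.
  move=> x; apply: cvgM; first exact: cvg_cst.
  by apply: powR_within => //; rewrite subr_gt0.
have dP (x : R) : 0 < x -> is_derive x 1 (@powR R ^~ s) (s * x `^ (s - 1)).
  exact: is_derive1_powR.
under eq_integral do rewrite /gamma_integrand addrK.
have := @integration_by_parts R (@powR R ^~ s) (fun x => - expR (- x))
  (fun x => s * x `^ (s - 1)) (fun x => expR (- x)) 0 b b0 cP.
rewrite powR0 ?gt_eqF// mul0r subr0 => ->//.
- rewrite (_ : (fun x : R => (s * x `^ (s - 1) * - expR (- x))%:E) =
    (fun x => - (s%:E * (gamma_integrand s x)%:E))%E); last first.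
    by apply/funext => x; rewrite -EFinM -EFinN mulrN mulrA.
  rewrite integral_ge0N; last first.
    by move=> x _; rewrite mule_ge0 ?lee_fin ?gamma_integrand_ge0 ?ltW.
  rewrite ge0_integralZl_EFin ?ltW//; last 2 first.
  + by move=> x _; rewrite lee_fin gamma_integrand_ge0.
  + apply/measurable_EFinP; apply: measurable_funTS.
    exact: measurable_gamma_integrand.
  by rewrite oppeK addeC mulrN EFinN.
- split.
  + by move=> x; rewrite in_itv/= => /andP[x0 _]; have [] := dP _ x0.
  + exact: powR_cvg0_right.
  + by apply: cvg_at_left_filter; exact: continuous_powR_pos.
- move=> x; rewrite in_itv/= => /andP[x0 _].
  by rewrite derive1E; have [_] := dP _ x0.
- split.
  + by move=> x _; apply: derivableN; have [] := is_derive_expRN x.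
  + by apply: cvg_at_right_filter; apply: cvgN; exact: continuous_expRN.
  + by apply: cvg_at_left_filter; apply: cvgN; exact: continuous_expRN.
- move=> x _; have [dx Ex] := is_derive_expRN x.
  by rewrite derive1E deriveN// Ex opprK.
Qed.

Lemma GammaE s :
  Gamma s = fine (\int[leb]_(t in `[0%R, +oo[) (gamma_integrand s t)%:E).
Proof.
rewrite /Gamma /Rintegral -integral_itv_obnd_cbnd//.
by apply/measurable_EFinP/measurable_funTS; exact: measurable_gamma_integrand.
Qed.

(** The limit b -> +oo of [gamma_parts] is taken in the extended reals; [Gamma]
    is the finite part, and multiplication by s > 0 preserves infinity. *)
Lemma Gamma_recurrence s : 1 < s -> Gamma (s + 1) = s * Gamma s.
Proof.
move=> s1; have s0 : 0 < s := lt_trans ltr01 s1.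
pose integ r n := (\int[leb]_(t in `[0%R, n%:R]) (gamma_integrand r t)%:E)%E.
pose J r := (\int[leb]_(t in `[0%R, +oo[) (gamma_integrand r t)%:E)%E.
have IJ r : integ r n @[n --> \oo] --> J r.
  apply: ge0_cvgn_integral; last exact: measurable_gamma_integrand.
  by move=> x; exact: gamma_integrand_ge0.
have J0 : (0 <= J s)%E.
  by apply: integral_ge0 => x _; rewrite lee_fin gamma_integrand_ge0.
suff EJ : J (s + 1) = (s%:E * J s)%E.
  rewrite !GammaE -/(J _) -/(J _) EJ.
  case: (J s) J0 => [r|_|//] /=; first by [].
  by rewrite gt0_muley ?lte_fin//= mulr0.
have c1 : (s%:E * integ s n - (n%:R `^ s * expR (- n%:R))%:E)%E @[n --> \oo]
    --> (s%:E * J s - 0%:E)%E.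
  apply: cvgeB; first by rewrite oppe0 fin_num_adde_defl.
  - by apply: cvgeZl => //; exact: IJ.
  - by apply: cvg_EFin; [exact: nearW|exact: cvg_powR_expR].
rewrite sube0 in c1.
have c2 : integ (s + 1) n @[n --> \oo] --> (s%:E * J s)%E.
  apply: cvg_trans c1; apply: near_eq_cvg.
  near=> n; have n0 : 0 < n%:R :> R by rewrite ltr0n; near: n; exists 1%N.
  exact/esym/(gamma_parts s1 n0).
have hd := @ereal_hausdorff R.
by rewrite -(cvg_lim hd c2) -(cvg_lim hd (IJ (s + 1))).
Unshelve. all: by end_near. Qed.

End gamma.

(** * Rules of derivation on the real line *)

Section real_derivatives.
Context {R : realType}.
Implicit Types (f g : R -> R) (x a b k r : R).

(** Rules for functions written pointwise on the real line, in a form that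
    composes into one proof term whose derivative is then rearranged by [ring]
    or [field]. *)
Lemma deriveR_cst k x : is_derive x 1 (fun _ : R => k) 0.
Proof. exact: is_derive_cst. Qed.

Lemma deriveR_id x : is_derive x 1 (fun y : R => y) 1.
Proof. exact: is_derive_id. Qed.

Lemma deriveRD f g x a b : is_derive x 1 f a -> is_derive x 1 g b ->
  is_derive x 1 (fun y => f y + g y) (a + b).
Proof. by move=> fa gb; exact: is_deriveD. Qed.

Lemma deriveRN f x a : is_derive x 1 f a -> is_derive x 1 (fun y => - f y) (- a).
Proof. by move=> fa; exact: is_deriveN. Qed.

Lemma deriveRM f g x a b : is_derive x 1 f a -> is_derive x 1 g b ->
  is_derive x 1 (fun y => f y * g y) (a * g x + f x * b).
Proof.
move=> fa gb; apply: is_derive_eq (is_deriveM fa gb) _.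
by rewrite addrC mulrC.
Qed.

Lemma deriveRV f x a : f x != 0 -> is_derive x 1 f a ->
  is_derive x 1 (fun y => (f y)^-1) (- a / f x ^+ 2).
Proof.
move=> fx0 fa; apply: is_derive_eq (is_deriveV fx0 fa) _.
by rewrite -[LHS]/(_ * _) mulrC mulrN mulNr.
Qed.

Lemma deriveR_comp f g x a b : is_derive (g x) 1 f a -> is_derive x 1 g b ->
  is_derive x 1 (fun y => f (g y)) (a * b).
Proof. exact: is_derive1_comp. Qed.

Lemma deriveR_powR r x : 0 < x ->
  is_derive x 1 (fun y => y `^ r) (r * x `^ (r - 1)).
Proof. exact: is_derive1_powR. Qed.

Lemma deriveR_continuous f x a : is_derive x 1 f a -> {for x, continuous f}.
Proof.
by move=> [fa _]; apply: differentiable_continuous; apply/derivable1_diffP.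
Qed.

End real_derivatives.

(** * Power series with factorially small coefficients *)

Section factorially_bounded.
Context {R : realType}.
Implicit Types (a : R^nat) (x : R).

(** A class of coefficients with infinite radius of convergence that is stable
    under termwise derivation. *)
Definition fact_bounded a := exists C, forall k, `|a k| <= C / k`!%:R.

Lemma fact_bounded_cvg a x : fact_bounded a -> cvgn (pseries a x).
Proof.
move=> [C aC]; apply: normed_cvg.
have cE : cvgn (series (C *: exp_coeff `|x|)).
  by apply: is_cvg_seriesZ; exact: is_cvg_series_exp_coeff.
apply: series_le_cvg cE => n /=; first exact: normr_ge0.
- have C0 : 0 <= C by have := aC 0%N; rewrite fact0 divr1; exact: le_trans.
  by rewrite -[leRHS]/(C * (`|x| ^+ n / n`!%:R)) mulr_ge0// divr_ge0// exprn_ge0.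
- rewrite -[leRHS]/(C * (`|x| ^+ n / n`!%:R)) normrM normrX mulrCA mulrC.
  by rewrite ler_wpM2l ?exprn_ge0.
Qed.

Lemma fact_bounded_diffs a : fact_bounded a -> fact_bounded (pseries_diffs a).
Proof.
move=> [C aC]; exists C => k; rewrite /pseries_diffs normrM ger0_norm//.
have k0 : (0 : R) < k.+1%:R by rewrite ltr0n.
rewrite -ler_pdivlMl// (le_trans (aC _))// factS natrM invfM.
by rewrite mulrCA.
Qed.

Lemma is_derive_pseries a x : fact_bounded a ->
  is_derive x 1 (fun x => limn (pseries a x)) (limn (pseries (pseries_diffs a) x)).
Proof.
move=> ba; apply: (@pseries_snd_diffs _ a (`|x| + 1)).
- exact: fact_bounded_cvg.
- exact/fact_bounded_cvg/fact_bounded_diffs.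
- exact/fact_bounded_cvg/fact_bounded_diffs/fact_bounded_diffs.
- by rewrite [ltRHS]ger0_norm ?addr_ge0// ltrDl.
Qed.

End factorially_bounded.

(** * Bessel functions *)

Section bessel_series.
Context {R : realType}.
Variable nu : R.
Hypothesis nu0 : 0 < nu.
Implicit Types (x q : R).

Definition bessel_coef (k : nat) : R :=
  (-1) ^+ k / (k`!%:R * Gamma (k%:R + nu + 1)).

(** The functional equation of Gamma, in terms of inverses; it also holds where
    Gamma is 0, since then both coefficients are 0. *)
Lemma bessel_coefS k :
  bessel_coef k = - (k.+1%:R * (k.+1%:R + nu) * bessel_coef k.+1).
Proof.
rewrite /bessel_coef.
have -> : Gamma (k.+1%:R + nu + 1) = (k.+1%:R + nu) * Gamma (k%:R + nu + 1) :> R.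
  rewrite Gamma_recurrence; last first.
    by rewrite -natr1 -addrA addrCA ltrDl ltr_wpDl.
  by rewrite -natr1 addrAC.
have k1 : k.+1%:R != 0 :> R by rewrite pnatr_eq0.
have k2 : k.+1%:R + nu != 0 :> R by rewrite gt_eqF// ltr_wpDl.
rewrite factS natrM !invfM exprS.
move: (Gamma _)^-1 (k`!%:R)^-1 ((-1) ^+ k) => g f e.
by field; rewrite nat1r k2 k1.
Qed.

Lemma bessel_coef_le k : `|bessel_coef k| <= `|bessel_coef 0| / k`!%:R.
Proof.
elim: k => [|k IH]; first by rewrite fact0 divr1.
have k0 : (0 : R) < k.+1%:R by rewrite ltr0n.
rewrite factS natrM invfM mulrCA -ler_pdivrMl ?invr_gt0// invrK.
apply: le_trans IH; rewrite [in leRHS]bessel_coefS normrN !normrM.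
rewrite (gtr0_norm k0) -mulrA ler_wpM2l//.
rewrite ler_peMl// ger0_norm ?addr_ge0 ?(ltW nu0)//.
by apply: ler_wpDr; [exact: ltW|rewrite ler1n].
Qed.

Lemma fact_bounded_bessel_coef : fact_bounded bessel_coef.
Proof. by exists `|bessel_coef 0|; exact: bessel_coef_le. Qed.

(** The entire function S such that J_nu(x) = (x / 2)^nu S((x / 2)^2), followed
    by its first two derivatives. *)
Definition bessel_pseries q : R := limn (pseries bessel_coef q).
Definition bessel_pseries1 q : R := limn (pseries (pseries_diffs bessel_coef) q).
Definition bessel_pseries2 q : R :=
  limn (pseries (pseries_diffs (pseries_diffs bessel_coef)) q).

Notation S := bessel_pseries.
Notation S1 := bessel_pseries1.
Notation S2 := bessel_pseries2.

Lemma is_derive_bessel_pseries q : is_derive q 1 S (S1 q).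
Proof. exact/is_derive_pseries/fact_bounded_bessel_coef. Qed.

Lemma is_derive_bessel_pseries1 q : is_derive q 1 S1 (S2 q).
Proof.
exact/is_derive_pseries/fact_bounded_diffs/fact_bounded_bessel_coef.
Qed.

(** The equation of Bessel in the variable q = (x / 2)^2, obtained by comparing
    coefficients. *)
Lemma bessel_pseries_ode q : q * S2 q + (nu + 1) * S1 q + S q = 0.
Proof.
have ba := fact_bounded_bessel_coef.
have b1 := fact_bounded_diffs ba; have b2 := fact_bounded_diffs b1.
have c0 : pseries bessel_coef q @ \oo --> S q by exact: fact_bounded_cvg.
have c1 : pseries (pseries_diffs bessel_coef) q @ \oo --> S1 q.
  exact: fact_bounded_cvg.
have c2 := pseries_diffs_equiv (fact_bounded_cvg (x := q) b2).
set s := (X in series X @ _ --> _) in c2.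
have c3 : (- (q * series s n + (nu + 1) * pseries (pseries_diffs bessel_coef) q n))
    @[n --> \oo] --> - (q * S2 q + (nu + 1) * S1 q).
  by apply: cvgN; apply: cvgD; apply: cvgMl_tmp.
apply/eqP; rewrite addrC addr_eq0; apply/eqP.
rewrite -(cvg_lim _ c0)// -(cvg_lim _ c3)//; apply: (congr1 (fun u : R^nat => limn u)).
apply/funext => n; rewrite /pseries /series/= !mulr_sumr -big_split/= -sumrN.
apply: eq_bigr => i _; rewrite bessel_coefS /s /pseries_diffs.
case: i => [|i]; first by rewrite !mul0r !mulr0 add0r expr0; ring.
by rewrite /= exprS -!natr1; ring.
Qed.

Lemma besselJE x : 0 < x -> besselJ nu x = (x / 2) `^ nu * S ((x / 2) ^+ 2).
Proof.
move=> x0; have x20 : 0 < x / 2 by rewrite divr_gt0.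
have ba := fact_bounded_bessel_coef.
rewrite /besselJ /S.
have c0 : pseries bessel_coef ((x / 2) ^+ 2) @ \oo --> S ((x / 2) ^+ 2).
  exact: fact_bounded_cvg.
have c1 : ((x / 2) `^ nu * pseries bessel_coef ((x / 2) ^+ 2) n) @[n --> \oo]
    --> (x / 2) `^ nu * S ((x / 2) ^+ 2).
  exact: cvgMl_tmp.
rewrite -(cvg_lim _ c1)//; apply: (congr1 (fun u : R^nat => limn u)).
apply/funext => n; rewrite /pseries /series/= mulr_sumr.
apply: eq_bigr => i _; rewrite powRD; last by rewrite (gt_eqF x20) implybT.
rewrite -natrM powR_mulrn ?(ltW x20)// exprM -/(bessel_coef i).
by ring.
Qed.

Lemma derive1_besselJ x : 0 < x -> x * derive1 (besselJ nu) x =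
  (x / 2) `^ nu * (nu * S ((x / 2) ^+ 2) + 2 * (x / 2) ^+ 2 * S1 ((x / 2) ^+ 2)).
Proof.
move=> x0; have x20 : 0 < x / 2 by rewrite divr_gt0.
have dh : is_derive x 1 (fun y : R => y / 2) (1 / 2).
  apply: is_derive_eq (deriveRM (deriveR_id x) (deriveR_cst 2^-1 x)) _.
  by rewrite mulr0 addr0.
have dq := deriveRM dh dh.
have dP := deriveR_comp (g := fun y => y / 2) (deriveR_powR nu x20) dh.
have dS := deriveR_comp (g := fun y => y / 2 * (y / 2)) (is_derive_bessel_pseries _) dq.
have dJ := deriveRM dP dS.
have EJ : \near x, (x / 2) `^ nu * S (x / 2 * (x / 2)) = besselJ nu x.
  near=> y; rewrite besselJE ?expr2//.
  by near: y; exact: lt_nbhsr.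
rewrite derive1E; have [_ ->] := near_eq_is_derive EJ dJ.
have -> : (x / 2) `^ (nu - 1) = (x / 2) `^ nu / (x / 2).
  by rewrite powRB ?powRr1 ?(ltW x20)// (gt_eqF x20) implybT.
rewrite -expr2; field; exact: lt0r_neq0.
Unshelve. all: by end_near. Qed.

Lemma continuous_bessel_pseries q : {for q, continuous S}.
Proof. exact: deriveR_continuous (is_derive_bessel_pseries q). Qed.

Lemma continuous_bessel_pseries1 q : {for q, continuous S1}.
Proof. exact: deriveR_continuous (is_derive_bessel_pseries1 q). Qed.

(** With q = (x / 2)^2, four times q^nu [bessel_energy] is x^2 J'(x)^2 + (x^2 -
    nu^2) J(x)^2. *)
Definition bessel_energy q :=
  nu * (q * S1 q * S q) + q * S q ^+ 2 + (q * S1 q) ^+ 2.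

Lemma is_derive_bessel_energy q : 0 < q ->
  is_derive q 1 (fun y => y `^ nu * bessel_energy y) (q `^ nu * S q ^+ 2).
Proof.
move=> q0; rewrite /bessel_energy.
have d0 := is_derive_bessel_pseries q.
have d1 := is_derive_bessel_pseries1 q.
have di := deriveR_id q.
have dqS1 := deriveRM di d1.
have dE := deriveRD (deriveRD (deriveRM (deriveR_cst nu q) (deriveRM dqS1 d0))
  (deriveRM di (deriveRM d0 d0))) (deriveRM dqS1 dqS1).
apply: is_derive_eq (deriveRM (deriveR_powR nu q0) dE) _.
rewrite powRB ?powRr1 ?(ltW q0)//; last by rewrite (gt_eqF q0) implybT.
have E : q * S2 q = - (nu + 1) * S1 q - S q.
  by have := bessel_pseries_ode q; lra.
have -> : nu * (q `^ nu / q) * (nu * (q * S1 q * S q) + q * (S q * S q) + q * S1 q * (q * S1 q))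
   = q `^ nu * nu * (nu * (S1 q * S q) + S q * S q + q * S1 q * S1 q).
  by field; exact: lt0r_neq0.
rewrite E; ring.
Qed.

(** q^nu [bessel_energy] vanishes at 0 and has the derivative q^nu S(q)^2 >= 0.
    *)
Lemma bessel_energy_ge0 q : 0 < q -> 0 <= bessel_energy q.
Proof.
move=> q0; pose F y := y `^ nu * bessel_energy y.
have cE (y : R) : {for y, continuous bessel_energy}.
  have c0 : {for y, continuous (fun z : R => z * S1 z)}.
    by apply: cvgM; [exact: cvg_id|exact: continuous_bessel_pseries1].
  apply: cvgD; [apply: cvgD|].
  - apply: cvgM; first exact: cvg_cst.
    by apply: cvgM; [exact: c0|exact: continuous_bessel_pseries].
  - apply: cvgM; first exact: cvg_id.
    by apply: cvgM; exact: continuous_bessel_pseries.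
  - by apply: cvgM; exact: c0.
have cF : {within `[0, q], continuous F}.
  move=> y; apply: cvgM; first exact: powR_within.
  by apply: continuous_subspaceT.
have dF (y : R) : y \in `]0, q[ -> is_derive y 1 F (y `^ nu * S y ^+ 2).
  by rewrite in_itv/= => /andP[y0 _]; exact: is_derive_bessel_energy.
have [y _] := MVT q0 dF cF.
rewrite subr0 {2}/F powR0 ?gt_eqF// mul0r subr0 => EF.
have : 0 <= F q by rewrite EF mulr_ge0 ?(ltW q0)// mulr_ge0 ?powR_ge0 ?sqr_ge0.
by rewrite pmulr_rge0 ?powR_gt0.
Qed.

(** With q = (x / 2)^2, this is (x J'(x) / J(x) - nu) / 2. *)
Definition bessel_ratio q := q * S1 q / S q.

Lemma is_derive_bessel_ratio q : 0 < q -> S q != 0 ->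
  is_derive q 1 bessel_ratio
    (- (nu * bessel_ratio q + q + bessel_ratio q ^+ 2) / q).
Proof.
move=> q0 Sq; rewrite /bessel_ratio.
have d0 := is_derive_bessel_pseries q.
have d1 := is_derive_bessel_pseries1 q.
have di := deriveR_id q.
apply: is_derive_eq (deriveRM (deriveRM di d1) (deriveRV Sq d0)) _.
have E : q * S2 q = - (nu + 1) * S1 q - S q.
  by have := bessel_pseries_ode q; lra.
by rewrite E; field; rewrite Sq lt0r_neq0.
Qed.

Lemma bessel_ratio_energy q : S q != 0 ->
  nu * bessel_ratio q + q + bessel_ratio q ^+ 2 = bessel_energy q / S q ^+ 2.
Proof. by move=> Sq; rewrite /bessel_ratio /bessel_energy; field. Qed.

(** By the equation of Bessel the derivative is minus the energy divided by q
    S(q)^2. *)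
Lemma bessel_ratio_nincr q0 : (forall q, 0 <= q <= q0 -> S q != 0) ->
  {in `[0, q0] &, {homo bessel_ratio : x y /~ x <= y}}.
Proof.
move=> Sn0 x y; rewrite !in_itv/= => /andP[x0 xq0] /andP[y0 yq0] xy.
have [q0E|q0n0] := eqVneq q0 0.
  have -> : x = y by apply/eqP; rewrite eq_le xy; lra.
  by [].
have q00 : 0 < q0 by rewrite lt_neqAle eq_sym q0n0; lra.
apply: (@ler0_derive1_nincr _ bessel_ratio 0 q0) => //.
- move=> z; rewrite in_itv/= => /andP[z0 zq].
  by have [] := is_derive_bessel_ratio z0 (Sn0 z ltac:(lra)).
- move=> z; rewrite in_itv/= => /andP[z0 zq].
  have Sz : S z != 0 by apply: Sn0; lra.
  rewrite derive1E; have [_ ->] := is_derive_bessel_ratio z0 Sz.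
  rewrite bessel_ratio_energy// mulNr oppr_le0.
  by rewrite !mulr_ge0 ?invr_ge0 ?sqr_ge0 ?bessel_energy_ge0 ?(ltW z0).
- move=> z; apply: continuous_in_subspaceT => {}z.
  rewrite inE/= in_itv/= => /andP[z0 zq].
  apply: cvgM; first by apply: cvgM; [exact: cvg_id|exact: continuous_bessel_pseries1].
  by apply: cvgV; [apply: Sn0; rewrite z0|exact: continuous_bessel_pseries].
Qed.

End bessel_series.

(** * The constant c *)

Section bessel_bound.
Context {R : realType}.
Implicit Types nu m lam : R.

Lemma bessel_pseries0 nu : bessel_pseries nu 0 = bessel_coef nu 0 :> R.
Proof.
apply: lim_near_cst => //; near=> n.
have n0 : (0 < n)%N by near: n; exists 1%N.
rewrite /pseries /series/= -(prednK n0) big_nat_recl// expr0 mulr1.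
by rewrite big1 ?addr0// => i _; rewrite expr0n mulr0.
Unshelve. all: by end_near. Qed.

(** Every coefficient is bounded by a multiple of the first one, so S(0) = 0
    would force S = 0. *)
Lemma bessel_pseries_neq0 nu q : 0 < nu ->
  bessel_pseries nu q != 0 -> bessel_pseries nu 0 != 0 :> R.
Proof.
move=> nu0; apply: contraNN; rewrite bessel_pseries0 => /eqP a0; apply/eqP.
rewrite /bessel_pseries; apply: lim_near_cst => //; near=> n.
rewrite /pseries /series/= big1// => i _.
have := bessel_coef_le nu0 i; rewrite a0 normr0 mul0r normr_le0 => /eqP ->.
by rewrite mul0r.
Unshelve. all: by end_near. Qed.

(** Either no least root exists and [bessel_c] takes its default value 0, or
    [bessel_c] is a root. In the latter case q0 = (z / 2)^2 at z = 2 c / m: then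
    S has no zero up to q0 because z lies before the first zero of J_nu, and the
    equation that defines c, divided by J_nu(z), prescribes the value of
    [bessel_ratio] at q0. *)
Lemma bessel_cP nu m lam : 0 < nu -> 0 < m ->
  bessel_c lam nu m = 0 \/
  exists q0, [/\ 0 < q0, bessel_c lam nu m ^+ 2 = m ^+ 2 * q0,
    forall q, 0 <= q <= q0 -> bessel_pseries nu q != 0 &
    lam = (1 + nu * m) / 2 + m * bessel_ratio nu q0].
Proof.
move=> nu0 m0; rewrite {1}/bessel_c /least; case: xgetP => [c cE|]; last by left.
move=> [[/andP[z0 zj] bc] _]; right.
have -> : bessel_c lam nu m = c by [].
set z := 2 / m * c in z0 zj bc.
have Jn0 x : 0 < x <= z -> besselJ nu x != 0.
  move: zj; rewrite /bessel_zero /least; case: xgetP => [j _|_ z0'].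
    move=> [[j0 Jj] jlb] zj /andP[x0 xz]; apply/eqP => Jx.
    by have /(le_lt_trans xz)/lt_le_trans := zj; move=> /(_ _ (jlb x (conj x0 Jx))); rewrite ltxx.
  by have := lt_trans z0 z0'; rewrite ltxx.
have z20 : 0 < z / 2 by rewrite divr_gt0.
have Sn0 q : 0 < q <= (z / 2) ^+ 2 -> bessel_pseries nu q != 0.
  move=> /andP[q0 qz]; pose x := 2 * Num.sqrt q.
  have x0 : 0 < x by rewrite mulr_gt0// sqrtr_gt0.
  have xz : x <= z.
    have : Num.sqrt q <= z / 2.
      by rewrite -(gtr0_norm z20) -sqrtr_sqr ler_sqrt// exprn_ge0// ltW.
    by rewrite /x; lra.
  have := Jn0 x; rewrite x0 xz => /(_ isT); rewrite besselJE// mulf_eq0 negb_or.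
  have -> : (x / 2) ^+ 2 = q.
    rewrite /x mulrAC divff ?mul1r; first by rewrite sqr_sqrtr// ltW.
    by rewrite pnatr_eq0.
  by case/andP.
have cE2 : c = m * (z / 2) by rewrite /z; field; rewrite lt0r_neq0.
exists ((z / 2) ^+ 2); split.
- by rewrite exprn_gt0.
- by rewrite cE2 exprMn.
- move=> q /andP[q0 qz]; have [->|qn0] := eqVneq q 0.
    by apply: (@bessel_pseries_neq0 _ ((z / 2) ^+ 2)) => //; apply: Sn0; rewrite exprn_gt0/=.
  by apply: Sn0; rewrite lt_neqAle eq_sym qn0 q0.
- have SS : bessel_pseries nu ((z / 2) ^+ 2) != 0 by apply: Sn0; rewrite exprn_gt0/=.
  have P0 : (z / 2) `^ nu != 0 by rewrite gt_eqF// powR_gt0.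
  have dJ := derive1_besselJ nu0 z0.
  move: bc; rewrite besselJE//.
  have -> : 2 * c * derive1 (besselJ nu) z = m * (z * derive1 (besselJ nu) z).
    by rewrite cE2; field.
  rewrite dJ /bessel_ratio.
  move: ((z / 2) `^ nu) (bessel_pseries nu _) (bessel_pseries1 nu _) SS P0.
  move=> P S S1 SS P0 bc.
  have {}bc : P * S * ((1 - 2 * lam) + m * (nu + 2 * ((z / 2) ^+ 2 * S1 / S))) = 0.
    by rewrite -[RHS]bc; field.
  move/eqP: bc; rewrite !mulf_eq0 (negPf P0) (negPf SS) /= => /eqP; lra.
Qed.

(** In terms of v(s) = s y'(s) / y(s), where y(s) = s^(1/2) J_nu((2 c / m) s^(m
    / 2)), the function H below has the derivative (lam^2 - v^2) / s^2 <= 0, and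
    the claim is H(1) <= H(t) together with v(t) <= L. This is for a root
    [bessel_c]; for the value 0 the right side minus the left side is (L - lam)
    ((L + lam) (1 - t) + t) + (lam - lam^2) t^m. *)
Lemma bessel_c_bound nu m lam t : let L := (1 + nu * m) / 2 in
  1 < m -> 0 < nu -> nu * m <= 1 ->
  0 <= lam < L -> 0 < t <= 1 ->
  (bessel_c lam nu m ^+ 2 / (m - 1) + lam - lam ^+ 2) * (t - t `^ m) <=
  L ^+ 2 - lam ^+ 2 + (L - L ^+ 2) * t.
Proof.
move=> L m1 nu0 num1 /andP[lam0 lamL] /andP[t0 t1].
have m0 : 0 < m := lt_trans ltr01 m1.
have L1 : L <= 1 by rewrite /L; lra.
have tm0 : 0 <= t `^ m := powR_ge0 _ _.
have ll0 : 0 <= lam - lam ^+ 2.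
  by rewrite expr2 -{1}[lam]mulr1 -mulrBr mulr_ge0// subr_ge0; lra.
have [->|] := bessel_cP lam nu0 m0.
  rewrite expr0n mul0r add0r.
  have : 0 <= (L - lam) * ((L + lam) * (1 - t) + t).
    apply: mulr_ge0; first by rewrite subr_ge0 ltW.
    by apply: addr_ge0; [apply: mulr_ge0; lra|exact: ltW].
  have : 0 <= (lam - lam ^+ 2) * t `^ m by exact: mulr_ge0.
  move: (t `^ m) => x; lra.
move=> [q0 [q00 cq Sn0 lamE]].
set c2 := bessel_c lam nu m ^+ 2 in cq *.
(* q (s) = ((c / m) s^(m / 2))^2 is the square of half the argument of J_nu. *)
pose q (s : R) : R := q0 * s `^ m.
pose v (s : R) : R := L + m * bessel_ratio nu (q s).
have qb (s : R) : 0 < s <= 1 -> 0 < q s <= q0.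
  move=> /andP[s0 s1]; rewrite /q mulr_gt0 ?powR_gt0//= ler_piMr ?(ltW q00)//.
  apply: (@le_trans _ _ (1 `^ m)); last by rewrite powR1.
  by apply: ge0_ler_powR; rewrite ?nnegrE ?(ltW m0) ?(ltW s0).
have v_ge (s : R) : 0 < s <= 1 -> lam <= v s.
  move=> /qb/andP[qs qs']; rewrite /v lamE lerD2l ler_pM2l//.
  apply: (bessel_ratio_nincr nu0 Sn0) => //; rewrite in_itv/= ?lexx ?(ltW q00)// (ltW qs)//.
have v_le (s : R) : 0 < s <= 1 -> v s <= L.
  move=> /qb/andP[qs qs']; rewrite /v gerDl pmulr_rle0//.
  rewrite [leRHS](_ : 0 = bessel_ratio nu 0); last by rewrite /bessel_ratio !mul0r.
  apply: (bessel_ratio_nincr nu0 Sn0); rewrite ?in_itv/= ?lexx ?(ltW q00)// (ltW qs)//.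
have v1 : v 1 = lam by rewrite /v /q powR1 mulr1 -lamE.
have dv (s : R) : 0 < s <= 1 ->
    is_derive s 1 v ((v s - v s ^+ 2 - (L - L ^+ 2) - c2 * s `^ m) / s).
  move=> s01; have /andP[s0 _] := s01; have /andP[qs qs'] := qb _ s01.
  have Sq : bessel_pseries nu (q s) != 0 by apply: Sn0; rewrite (ltW qs).
  have dq : is_derive s 1 q (q0 * (m * s `^ (m - 1))).
    apply: is_derive_eq (deriveRM (deriveR_cst q0 s) (deriveR_powR m s0)) _.
    by rewrite mul0r add0r.
  have dR := deriveR_comp (g := q) (is_derive_bessel_ratio nu0 qs Sq) dq.
  apply: is_derive_eq (deriveRD (deriveR_cst L s) (deriveRM (deriveR_cst m s) dR)) _.
  rewrite powRB ?powRr1 ?(ltW s0)//; last by rewrite (gt_eqF s0) implybT.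
  rewrite cq /v /L; set r := bessel_ratio _ _; rewrite /q.
  have sm : s `^ m != 0 by rewrite gt_eqF// powR_gt0.
  by field; rewrite !lt0r_neq0// powR_gt0.
pose H (s : R) : R := v s / s - (L - L ^+ 2 + lam ^+ 2) / s + c2 / (m - 1) * s `^ (m - 1).
have dH (s : R) : 0 < s <= 1 -> is_derive s 1 H ((lam ^+ 2 - v s ^+ 2) / s ^+ 2).
  move=> s01; have /andP[s0 _] := s01.
  have sn0 := lt0r_neq0 s0.
  have di := deriveRV (f := fun x => x) sn0 (deriveR_id s).
  apply: is_derive_eq (deriveRD (deriveRD (deriveRM (dv _ s01) di)
    (deriveRN (deriveRM (deriveR_cst (L - L ^+ 2 + lam ^+ 2) s) di)))
    (deriveRM (deriveR_cst (c2 / (m - 1)) s) (deriveR_powR (m - 1) s0))) _.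
  rewrite !powRB ?powRr1 ?(ltW s0)// ?(gt_eqF s0) ?implybT//.
  by field; rewrite sn0 subr_eq0 gt_eqF.
have Hm : H 1 <= H t.
  apply: (@ler0_derive1_nincr _ H t 1) (lexx t) t1 (lexx 1).
  - move=> x; rewrite in_itv/= => /andP[tx x1].
    by have [] := dH x ltac:(by rewrite (lt_trans t0 tx) ltW).
  - move=> x; rewrite in_itv/= => /andP[tx x1].
    have x01 : 0 < x <= 1 by rewrite (lt_trans t0 tx) ltW.
    have [_ Hx] := dH x x01; rewrite derive1E Hx.
    rewrite pmulr_lle0 ?invr_gt0 ?exprn_gt0 ?(lt_trans t0)// subr_le0.
    by rewrite lerXn2r ?nnegrE ?(le_trans lam0) ?v_ge.
  - move=> x; apply: continuous_in_subspaceT => {}x.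
    rewrite inE/= in_itv/= => /andP[tx x1].
    by apply: deriveR_continuous (dH x _); rewrite (lt_le_trans t0 tx).
have vt := v_le t ltac:(by rewrite t0 t1).
move: Hm; rewrite /H v1 powR1 !divr1 -(ler_pM2r t0).
rewrite powRB ?powRr1 ?(ltW t0)//; last by rewrite (gt_eqF t0) implybT.
have tn0 := lt0r_neq0 t0.
have -> : (v t / t - (L - L ^+ 2 + lam ^+ 2) / t + c2 / (m - 1) * (t `^ m / t)) * t
  = v t - (L - L ^+ 2 + lam ^+ 2) + c2 / (m - 1) * t `^ m.
  by field; rewrite tn0 subr_eq0 gt_eqF.
have : 0 <= (lam - lam ^+ 2) * t `^ m by exact: mulr_ge0.
move: (c2 / (m - 1)) (t `^ m) => d x; lra.
Qed.

End bessel_bound.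

(** * Translation invariance of Lebesgue measure *)

Section measure_rV.
Context {R : realType} {n : nat}.
Notation mT := (measurableTypeR R).
Notation V := 'rV[R]_n.
Notation mV := 'rV[measurableTypeR R]_n.
Notation leb := (@lebesgue_measure R).
Notation mu := (@lebesgue_measure_rV R n).

Definition box (A : 'I_n -> set mT) : set mV := [set x | forall i, A i (x ord0 i)].

Lemma measurable_coord i : measurable_fun [set: mV] (fun x : mV => x ord0 i).
Proof.
have /measurable_fun_rVP := @measurable_id _ mV setT; exact.
Qed.

Lemma measurable_box (A : 'I_n -> set mT) :
  (forall i, measurable (A i)) -> measurable (box A).
Proof.
move=> mA; rewrite (_ : box A =
    \big[setI/setT]_(i < n) ((fun x : mV => x ord0 i) @^-1` A i)).
  apply: bigsetI_measurable => i _; rewrite -[X in measurable X]setTI.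
  by apply: measurable_coord => //; exact: mA.
apply/seteqP; split=> x /=; rewrite -bigcap_seq.
  by move=> h i _; exact: h.
by move=> h i; apply: h => /=; rewrite mem_index_enum.
Qed.

Definition boxes : set (set mV) :=
  [set B | exists2 A, (forall i, measurable (A i)) & B = box A].

(** Boxes, unlike the generating preimages under one coordinate, form a
    pi-system. *)
Lemma measurable_rV_boxes : measurable = <<s boxes >>.
Proof.
apply/seteqP; split.
  apply: smallest_sub; first exact: smallest_sigma_algebra.
  move=> B; rewrite -bigcup_seq => -[i _ [A mA <-]].
  apply: sub_sigma_algebra; rewrite setTI.
  exists (fun j => if j == i then A else setT).
    by move=> j; case: ifPn.
  apply/seteqP; split => x /= h; last by have := h i; rewrite eqxx.
  by move=> j; case: eqP => [->|].
apply: smallest_sub; first exact: sigma_algebra_measurable.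
by move=> _ [A mA ->]; exact: measurable_box.
Qed.

Lemma setI_closed_boxes : setI_closed boxes.
Proof.
move=> _ _ [A mA ->] [B mB ->]; exists (fun i => A i `&` B i).
  by move=> i; exact: measurableI.
apply/seteqP; split => x /=; first by move=> [Ax Bx] i; split.
by move=> AB; split => i; have [] := AB i.
Qed.

Lemma lebesgue_measure_shift (a : R) (A : set mT) : measurable A ->
  leb [set x | A (x + a)] = leb A.
Proof.
move=> mA; have ma : measurable_fun setT ((fun x => x + a) : mT -> mT).
  by apply: measurable_funD => //; exact: measurable_id.
pose nu := measure_function_pushforward__canonical__measure_function_Measure leb ma.
apply/esym; apply: (@lebesgue_measure_unique R nu) => // _ [[p q] _ <-].
rewrite /nu /= /pushforward.
rewrite (_ : _ @^-1` _ = `]p - a, q - a]%classic); last first.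
  by apply/seteqP; split => x /=; rewrite !in_itv/= ltrBlDr lerBrDr.
rewrite !lebesgue_measure_itv/= !lte_fin ltrD2r; case: ifP => // _.
by rewrite -!EFinB; congr (_%:E); ring.
Qed.

Definition cube (k : R) : set mV := box (fun=> `[- k, k]%classic).

Lemma measurable_cube k : measurable (cube k).
Proof. by apply: measurable_box => i. Qed.

Lemma lebesgue_measure_box (A : 'I_n -> set mT) : (forall i, measurable (A i)) ->
  mu (box A) = (\prod_(i < n) leb (A i))%E.
Proof. exact: lebesgue_measure_rV_box. Qed.

Lemma cube_fin k : (mu (cube k) < +oo)%E.
Proof.
rewrite /cube lebesgue_measure_box//.
rewrite ltey_eq; apply/orP; left.
elim/big_ind : _ => [//|x y xoo yoo|i _]; first by rewrite fin_numM.
by rewrite lebesgue_measure_itv/=; case: ifP.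
Qed.

Lemma norm_coord_le (x : V) i : `|x ord0 i| <= `|x|.
Proof.
rewrite [leRHS]/Num.norm/= mx_normrE.
by apply/bigmax_geP; right; exists (ord0, i).
Qed.

Lemma cube_cover : \bigcup_k cube k%:R = setT.
Proof.
apply/seteqP; split => // x _; exists (Num.trunc `|x|).+1 => // i /=.
rewrite in_itv/= -ler_norml; apply: (@le_trans _ _ `|x|).
  exact: norm_coord_le.
exact/ltW/truncnS_gt.
Qed.

(** Both sides are measures in A that agree on boxes, by invariance in dimension
    one. *)
Lemma lebesgue_measure_rV_shift (a : V) (A : set mV) : measurable A ->
  mu [set x | A (x + a)] = mu A.
Proof.
move=> mA; have ma : measurable_fun setT ((fun x => x + a) : mV -> mV).
  apply/measurable_fun_rVP => i.
  rewrite (_ : (fun x : mV => _) = (fun x : mV => x ord0 i + a ord0 i)).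
    by apply: measurable_funD => //; exact: measurable_coord.
  by apply/funext => x; rewrite mxE.
pose nu := measure_function_pushforward__canonical__measure_function_Measure mu ma.
apply/esym; apply: (@measure_unique _ R _ boxes (fun k => cube k%:R)
  measurable_rV_boxes setI_closed_boxes _ cube_cover mu nu) => //.
- by move=> k; exists (fun=> `[- k%:R, k%:R]%classic).
- move=> _ [B mB ->]; rewrite /nu /= /pushforward.
  rewrite (_ : _ @^-1` _ = box (fun i => [set x | B i (x + a ord0 i)])).
    rewrite !lebesgue_measure_box//.
      by apply: eq_bigr => i _; rewrite lebesgue_measure_shift.
    move=> i; rewrite -[X in measurable X]setTI.
    have : measurable_fun setT ((fun x => x + a ord0 i) : mT -> mT).
      by apply: measurable_funD => //; exact: measurable_id.
    by apply.
  by apply/seteqP; split => x /= h i; have := h i; rewrite mxE.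
- by move=> k; exact: cube_fin.
Qed.

(** An open set is the union of the open cubes with rational centre and side 2 /
    (k + 1) that it contains, and these are countably many. *)
Lemma open_measurable_rV (U : set V) : open U -> measurable (U : set mV).
Proof.
move=> oU.
pose B (q : 'rV[rat]_n) (k : nat) : set mV :=
  box (fun i => `]ratr (q ord0 i) - k.+1%:R^-1, ratr (q ord0 i) + k.+1%:R^-1[%classic).
pose F (p : 'rV[rat]_n * nat) : set mV :=
  if `[< B p.1 p.2 `<=` U >] then B p.1 p.2 else set0.
rewrite (_ : U = \bigcup_p F p); last first.
  apply/seteqP; split => x; last first.
    by move=> [p _]; rewrite /F; case: asboolP => // BU; exact: BU.
  move=> Ux.
  have /nbhs_ballP[e /= e0 eU] : nbhs x U by exact: open_nbhs_nbhs.
  pose k := Num.trunc (2 / e).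
  have k0 : 0 < k.+1%:R^-1 :> R by rewrite invr_gt0.
  have ke : k.+1%:R^-1 + k.+1%:R^-1 < e.
    have -> : k.+1%:R^-1 + k.+1%:R^-1 = 2 / k.+1%:R :> R by ring.
    by rewrite ltr_pdivrMr// mulrC -ltr_pdivrMr// truncnS_gt.
  have /choice[q qx] : forall i, exists q : rat, `|x ord0 i - ratr q| < k.+1%:R^-1.
    move=> i; have [|q] := @rat_in_itvoo R (x ord0 i - k.+1%:R^-1) (x ord0 i + k.+1%:R^-1).
      by rewrite ltrBlDr -addrA ltrDl addr_gt0.
    rewrite in_itv/= => /andP[q1 q2]; exists q; rewrite ltr_norml.
    move: (ratr q) (k.+1%:R^-1) q1 q2 => r d q1 q2; apply/andP; split; lra.
  exists (\row_i q i, k) => //=; rewrite /F; case: asboolP => [_|]; last first.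
    case=> y /= By; apply: eU; split=> // i j.
    rewrite (ord1 i) -ball_normE/=; have := By j; have := qx j.
    rewrite /= in_itv/= mxE !ltr_norml.
    move: (ratr _) (k.+1%:R^-1) ke => r d ke /andP[? ?] /andP[? ?].
    by apply/andP; split; lra.
  move=> i; have := qx i; rewrite /= in_itv/= mxE ltr_norml.
  by move: (ratr _) (k.+1%:R^-1) => r d /andP[? ?]; apply/andP; split; lra.
apply: countable_bigcupT_measurable; first exact: countableP.
move=> [q k]; rewrite /F; case: ifP => _ //=.
by apply: measurable_box => i; exact: measurable_itv.
Qed.

Lemma continuous_measurable_rV (f : V -> R) : continuous f ->
  measurable_fun [set: mV] (f : mV -> mT).
Proof.
move=> /continuousP cf; apply: (measurability _ (RGenOpens.measurableE R)).
move=> _ [_ [a [b ->] <-]]; rewrite setTI; apply: open_measurable_rV.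
exact/cf/interval_open.
Qed.

End measure_rV.

(** * Continuous functions with compact support *)

Section uniform_continuity.
Context {R : realType} {X : normedModType R}.

(** Only x is confined to K, so that continuity is uniform up to points just
    outside K. *)
Lemma compact_uniform_continuous (f : X -> R) (K : set X) (e : R) :
  compact K -> (forall x, K x -> {for x, continuous f}) -> 0 < e ->
  exists2 r, 0 < r & forall x y, K x -> `|x - y| < r -> `|f x - f y| < e.
Proof.
move=> /compact_near_coveringP cK cf e0.
have /(cK R (0 : R)^'+ (fun r x => forall y, `|x - y| < r -> `|f x - f y| < e)) :
    forall x, K x -> \forall x' \near x & r \near (0 : R)^'+,
    forall y, `|x' - y| < r -> `|f x' - f y| < e.
  move=> x Kx; have e20 : 0 < e / 2 by rewrite divr_gt0.
  have /cvgrPdist_lt/(_ _ e20)/nbhs_normP[d /= d0 df] := cf x Kx.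
  have d20 : 0 < d / 2 by rewrite divr_gt0.
  exists (ball x (d / 2), [set r | r < d / 2]) => /=.
    by split; [exact: nbhsx_ballx|exact: nbhs_right_lt].
  move=> [x' r] /= [xx' rd] y x'y; move: xx'; rewrite -ball_normE/= => xx'.
  have h1 : `|f x - f x'| < e / 2 by apply: df; rewrite /=; lra.
  have h2 : `|f x - f y| < e / 2.
    by apply: df => /=; have := ler_distD x' x y; lra.
  by have := ler_distD (f x) (f x') (f y); rewrite (distrC (f x') (f x)); lra.
move=> H; near (0 : R)^'+ => r; exists r => // x y Kx xy.
by have := near H r; apply.
Unshelve. all: by end_near. Qed.

End uniform_continuity.

Section compact_support.
Context {R : realType} {n : nat}.
Notation V := 'rV[R]_n.
Notation mV := 'rV[measurableTypeR R]_n.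
Notation mu := (@lebesgue_measure_rV R n).
Implicit Types (phi psi u : V -> R).

Definition Cc phi := continuous phi /\ exists M, forall x, M < `|x| -> phi x = 0.

Lemma compact_closed_ball0 (M : R) : compact [set x : V | `|x| <= M].
Proof.
apply: bounded_closed_compact.
  by exists M; split; [exact: num_real|move=> r Mr x /= /le_trans; apply; exact: ltW].
apply: (@closed_comp _ _ (fun x : V => `|x|) [set r | r <= M]).
  by move=> x _; exact: norm_continuous.
exact: closed_le.
Qed.

Lemma Cc_bounded phi : Cc phi -> exists C, forall x, `|phi x| <= C.
Proof.
move=> [cphi [M phi0]].
have : bounded_set (phi @` [set x : V | `|x| <= M]).
  apply: compact_bounded; apply: continuous_compact.
    exact: continuous_subspaceT.
  exact: compact_closed_ball0.
move=> [C [_ HC]]; exists (`|C| + 1) => x.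
have [Mx|xM] := ltP M `|x|; first by rewrite phi0// normr0 addr_ge0.
apply: HC; last by exists x.
by rewrite (le_lt_trans (ler_norm _))// ltrDl.
Qed.

Lemma Cc_uniform phi e : Cc phi -> 0 < e ->
  exists2 r, 0 < r & forall x y, `|x - y| < r -> `|phi x - phi y| < e.
Proof.
move=> [cphi [M phi0]] e0.
have [r r0 Hr] := compact_uniform_continuous (K := [set x : V | `|x| <= M + 1])
  (compact_closed_ball0 (M := M + 1)) (fun x _ => cphi x) e0.
exists (Num.min r 1); first by rewrite lt_min r0/=.
move=> x y; rewrite lt_min => /andP[xyr xy1].
have [Mx|xM] := ltP (M + 1) `|x|; last exact: Hr.
have := lerB_dist x y => h.
by rewrite !phi0 ?subrr ?normr0//; lra.
Qed.

Lemma Cc_integrable phi : Cc phi -> mu.-integrable setT (EFin \o phi).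
Proof.
move=> ccphi; have [C phiC] := Cc_bounded ccphi; have [cphi [M phi0]] := ccphi.
have /integrable_mkcond H : mu.-integrable (cube M) (EFin \o phi).
  apply: measurable_bounded_integrable.
  - exact: measurable_cube.
  - exact: cube_fin.
  - by apply: measurable_funTS; exact: continuous_measurable_rV.
  - exists C; split; first exact: num_real.
    by move=> r Cr x _ /=; apply: le_trans (phiC x) _; exact: ltW.
have {}H := H (measurable_cube M).
rewrite (_ : EFin \o phi = (EFin \o phi) \_ (cube M))//.
apply/funext => x; rewrite patchE; case: ifPn => //.
rewrite notin_setE => xM; rewrite /= phi0//.
rewrite ltNge; apply: contra_notN xM => xM i /=; rewrite in_itv/= -ler_norml.
exact: le_trans (norm_coord_le _ _) xM.
Qed.

Definition integ phi : R := \int[mu]_x phi x.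

Lemma integD phi psi : Cc phi -> Cc psi -> integ (fun x => phi x + psi x) = integ phi + integ psi.
Proof. by move=> cp cq; rewrite /integ RintegralD//; exact: Cc_integrable. Qed.

Lemma integZ k phi : Cc phi -> integ (fun x => k * phi x) = k * integ phi.
Proof. by move=> cp; rewrite /integ RintegralZl//; exact: Cc_integrable. Qed.

Lemma le_integ phi psi : Cc phi -> Cc psi -> (forall x, phi x <= psi x) -> integ phi <= integ psi.
Proof. by move=> cp cq pq; apply: le_Rintegral => //; exact: Cc_integrable. Qed.

Lemma continuous_translate u (h : V) : continuous u -> continuous (fun x : V => u (x + h)).
Proof.
move=> cu x; apply: (@continuous_comp _ _ _ (fun x : V => x + h) u); last exact: cu.
apply: continuousD; first by move=> ?; apply.
exact: cst_continuous.
Qed.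

Lemma Cc_comp_shift (h : V) phi : Cc phi -> Cc (fun x => phi (x + h)).
Proof.
move=> [cp [M p0]]; split; first exact: continuous_translate.
exists (M + `|h|) => x Mx; apply: p0.
by have := ler_normB (x + h) h; rewrite addrK; lra.
Qed.

Lemma integ_shift (h : V) phi : Cc phi -> integ (fun x => phi (x + h)) = integ phi.
Proof.
move=> cphi; rewrite /integ /Rintegral; congr fine.
have mh : measurable_fun setT ((fun x => x + h) : mV -> mV).
  apply/measurable_fun_rVP => i.
  rewrite (_ : (fun x : mV => _) = (fun x : mV => x ord0 i + h ord0 i)).
    by apply: measurable_funD => //; exact: measurable_coord.
  by apply/funext => x; rewrite mxE.
pose nu := measure_function_pushforward__canonical__measure_function_Measure mu mh.
have -> : (\int[mu]_x (phi x)%:E = \int[nu]_x (phi x)%:E)%E.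
  apply: eq_measure_integral => A mA _.
  by rewrite /nu/= /pushforward; exact/esym/(lebesgue_measure_rV_shift h mA).
rewrite [RHS](integral_pushforward mh)//.
- by apply/measurable_EFinP; apply: continuous_measurable_rV; case: cphi.
- by rewrite preimage_setT; apply: (Cc_integrable (Cc_comp_shift h cphi)).
Qed.

Lemma Cc_mul phi u : Cc phi -> continuous u -> Cc (fun x => phi x * u x).
Proof.
move=> [cp [M p0]] cu; split; first by move=> x; apply: continuousM; [exact: cp|exact: cu].
by exists M => x Mx; rewrite p0// mul0r.
Qed.

Lemma Cc_add phi psi : Cc phi -> Cc psi -> Cc (fun x => phi x + psi x).
Proof.
move=> [cp [M p0]] [cq [N q0]]; split.
  by move=> x; apply: continuousD; [exact: cp|exact: cq].
exists (Num.max M N) => x; rewrite gt_max => /andP[Mx Nx].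
by rewrite p0// q0// addr0.
Qed.

Lemma Cc_scale k phi : Cc phi -> Cc (fun x => k * phi x).
Proof.
move=> cp; rewrite (_ : (fun x => _) = (fun x => phi x * k)).
  by apply: Cc_mul => // x; exact: cst_continuous.
by apply/funext => x; rewrite mulrC.
Qed.

Lemma Cc0 : Cc (fun=> 0).
Proof. by split; [move=> x; exact: cst_continuous|exists 0]. Qed.

Lemma Cc_sum (J : finType) (F : J -> V -> R) :
  (forall i, Cc (F i)) -> Cc (fun x => \sum_i F i x).
Proof.
move=> cF; rewrite (_ : (fun x => _) = \sum_i F i); last first.
  by apply/funext => x; rewrite fct_sumE.
by elim/big_ind : _ => //; [exact: Cc0|exact: Cc_add].
Qed.

Lemma integ_sum (J : finType) (F : J -> V -> R) :
  (forall i, Cc (F i)) -> integ (fun x => \sum_i F i x) = \sum_i integ (F i).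
Proof.
move=> cF.
rewrite (_ : (fun x => \sum_i F i x) = \sum_i F i); last first.
  by apply/funext => x; rewrite fct_sumE.
suff [] : Cc (\sum_i F i) /\ integ (\sum_i F i) = \sum_i integ (F i) by [].
elim/big_ind2 : _ => //.
- split; first exact: Cc0.
  rewrite (_ : 0 = (fun=> 0 * 0))//; first by rewrite (integZ 0 Cc0) mul0r.
  by apply/funext => x; rewrite mul0r.
- move=> f a g b [cf fa] [cg gb]; split; first exact: Cc_add.
  by rewrite -fa -gb; exact: integD.
Qed.

(** The term in u (x - h) is translated by h. *)
Lemma discrete_parts phi u (h : V) : Cc phi -> continuous u ->
  integ (fun x => phi x * (u x + u x - u (x + h) - u (x - h))) =
  integ (fun x => (phi (x + h) - phi x) * (u (x + h) - u x)).
Proof.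
move=> cp cu.
have cs (a : V) := @continuous_translate u a cu.
have c1 : Cc (fun x => phi x * (u x - u (x + h))).
  by apply: Cc_mul => // x; apply: continuousB; [exact: cu|exact: cs].
have c2 : Cc (fun x => phi x * (u x - u (x - h))).
  by apply: Cc_mul => // x; apply: continuousB; [exact: cu|exact: cs].
transitivity (integ (fun x => phi x * (u x - u (x + h))) +
              integ (fun x => phi x * (u x - u (x - h)))).
  by rewrite -integD//; apply: (congr1 integ); apply/funext => x; ring.
rewrite -(integ_shift h c2) -integD//; last exact: (Cc_comp_shift h c2).
by apply: (congr1 integ); apply/funext => x; rewrite addrK; ring.
Qed.

End compact_support.

(** * The Euclidean norm *)

Section euclid.
Context {R : realType} {n : nat}.
Notation V := 'rV[R]_n.
Implicit Types (x y z v : V) (a k : R).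

Definition dot x y : R := \sum_(i < n) x ord0 i * y ord0 i.

Lemma dotC x y : dot x y = dot y x.
Proof. by apply: eq_bigr => i _; rewrite mulrC. Qed.

Lemma dotDl x y z : dot (x + y) z = dot x z + dot y z.
Proof. by rewrite /dot -big_split/=; apply: eq_bigr => i _; rewrite mxE mulrDl. Qed.

Lemma dotZl k x y : dot (k *: x) y = k * dot x y.
Proof. by rewrite /dot mulr_sumr; apply: eq_bigr => i _; rewrite mxE mulrA. Qed.

Lemma dotDr x y z : dot z (x + y) = dot z x + dot z y.
Proof. by rewrite dotC dotDl !(dotC _ z). Qed.

Lemma dotZr k x y : dot x (k *: y) = k * dot x y.
Proof. by rewrite dotC dotZl dotC. Qed.

Lemma dotNl x y : dot (- x) y = - dot x y.
Proof. by rewrite -scaleN1r dotZl mulN1r. Qed.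

Lemma dotNr x y : dot x (- y) = - dot x y.
Proof. by rewrite dotC dotNl dotC. Qed.

Lemma enorm_ge0 x : 0 <= enorm x.
Proof. exact: sqrtr_ge0. Qed.

Lemma enorm_sqr x : enorm x ^+ 2 = dot x x.
Proof.
rewrite /enorm sqr_sqrtr; last by apply: sumr_ge0 => i _; exact: sqr_ge0.
by apply: eq_bigr => i _; rewrite expr2.
Qed.

Lemma enormZ k x : enorm (k *: x) = `|k| * enorm x.
Proof.
rewrite /enorm -(sqrtr_sqr k) -sqrtrM ?sqr_ge0//; congr Num.sqrt.
by rewrite mulr_sumr; apply: eq_bigr => i _; rewrite mxE exprMn.
Qed.

Lemma enormN x : enorm (- x) = enorm x.
Proof. by rewrite -scaleN1r enormZ normrN normr1 mul1r. Qed.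

Lemma enormB x y : enorm (x - y) = enorm (y - x).
Proof. by rewrite -enormN opprB. Qed.

Lemma enorm0 : enorm (0 : V) = 0.
Proof. by rewrite -(scale0r (0 : V)) enormZ normr0 mul0r. Qed.

Lemma coord_le_enorm x i : `|x ord0 i| <= enorm x.
Proof.
rewrite -sqrtr_sqr /enorm ler_sqrt; last by apply: sumr_ge0 => j _; exact: sqr_ge0.
by rewrite (bigD1 i)//= lerDl; apply: sumr_ge0 => j _; exact: sqr_ge0.
Qed.

Lemma norm_le_enorm x : `|x| <= enorm x.
Proof.
rewrite [leLHS]/Num.norm/= mx_normrE; apply/bigmax_leP; split; first exact: enorm_ge0.
by move=> [i j] _ /=; rewrite (ord1 i); exact: coord_le_enorm.
Qed.

Lemma enorm_le_sum x : enorm x <= \sum_(i < n) `|x ord0 i|.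
Proof.
have s0 : 0 <= \sum_(i < n) `|x ord0 i| by apply: sumr_ge0.
rewrite -(ger0_norm s0) -sqrtr_sqr /enorm ler_sqrt ?sqr_ge0//.
rewrite expr2 mulr_suml; apply: ler_sum => i _.
rewrite -[leLHS]ger0_norm ?sqr_ge0// normrX expr2 ler_wpM2l//.
by rewrite (bigD1 i)//= lerDl; exact: sumr_ge0.
Qed.

Lemma enorm_le_norm x : enorm x <= n%:R * `|x|.
Proof.
apply: le_trans (enorm_le_sum x) _.
rewrite -[X in X%:R * _]card_ord mulr_natl -sumr_const.
by apply: ler_sum => i _; exact: norm_coord_le.
Qed.

Lemma enorm_eq0 x : enorm x = 0 -> x = 0.
Proof.
move=> x0; apply/eqP; rewrite -normr_eq0 eq_le normr_ge0 andbT -x0.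
exact: norm_le_enorm.
Qed.

Lemma dot_le_enorm x y : dot x y <= enorm x * enorm y.
Proof.
have [y0|y0] := eqVneq (enorm y) 0.
  rewrite y0 mulr0 (enorm_eq0 y0) /dot big1// => i _; by rewrite mxE mulr0.
have yp : 0 < enorm y by rewrite lt_neqAle eq_sym y0 enorm_ge0.
have [x0|x0] := eqVneq (enorm x) 0.
  rewrite x0 mul0r (enorm_eq0 x0) /dot big1// => i _; by rewrite mxE mul0r.
have xp : 0 < enorm x by rewrite lt_neqAle eq_sym x0 enorm_ge0.
have : 0 <= dot (enorm y *: x - enorm x *: y) (enorm y *: x - enorm x *: y).
  by rewrite -enorm_sqr sqr_ge0.
rewrite !(dotDl, dotDr, dotNl, dotNr, dotZl, dotZr) -!enorm_sqr (dotC y x).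
move: (enorm x) (enorm y) (dot x y) xp yp => a b c a0 b0 h.
have : 0 <= a * b * (2 * (a * b - c)).
  by apply: (le_trans h); rewrite le_eqVlt; apply/orP; left; apply/eqP; ring.
by rewrite pmulr_rge0 ?mulr_gt0// pmulr_rge0// subr_ge0.
Qed.

Lemma enorm_sqrD x y k :
  enorm (x + k *: y) ^+ 2 = enorm x ^+ 2 + 2 * k * dot x y + k ^+ 2 * enorm y ^+ 2.
Proof.
by rewrite !enorm_sqr !(dotDl, dotDr, dotZl, dotZr) (dotC y x); ring.
Qed.

Lemma enormD x y : enorm (x + y) <= enorm x + enorm y.
Proof.
rewrite -(@ler_pXn2r _ 2)// ?nnegrE ?addr_ge0 ?enorm_ge0//.
rewrite enorm_sqr !(dotDl, dotDr) -!enorm_sqr (dotC y x).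
by have := dot_le_enorm x y; rewrite sqrrD; lra.
Qed.

Lemma enorm_dist x y z : enorm (x - z) <= enorm (x - y) + enorm (y - z).
Proof. by rewrite -[x - z](subrKA y); exact: enormD. Qed.

Lemma lipschitz_continuous (f : V -> R) k :
  (forall x y, f x - f y <= k * enorm (x - y)) -> continuous f.
Proof.
move=> fk x B /nbhs_ballP[e /= e0 eB].
have K0 : 0 < `|k| * n%:R + 1 by rewrite ltr_wpDl// mulr_ge0.
apply/nbhs_ballP; exists (e / (`|k| * n%:R + 1)) => /=; first by rewrite divr_gt0.
have fk' (y z : V) : `|y - z| < e / (`|k| * n%:R + 1) -> f y - f z < e.
  rewrite ltr_pdivlMr// => h; apply: le_lt_trans (fk y z) _; apply: le_lt_trans h.
  apply: (@le_trans _ _ (`|k| * enorm (y - z))).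
    by rewrite ler_wpM2r ?enorm_ge0// ler_norm.
  rewrite mulrDr mulr1 ler_wpDr// [leRHS]mulrC -mulrA ler_wpM2l//.
  exact: enorm_le_norm.
move=> y; rewrite -ball_normE/= => xy; apply: eB; rewrite -ball_normE/= ltr_norml.
by apply/andP; split; [rewrite ltrNl opprB; apply: fk'; rewrite distrC|exact: fk'].
Qed.

Lemma enorm_continuous : continuous (@enorm R n).
Proof.
apply: (@lipschitz_continuous _ 1) => x y; rewrite mul1r.
by have := enormD (x - y) y; rewrite subrK; lra.
Qed.

(** At A = boundary Omega this is the finite part of [delta] Omega x. *)
(** * Distance to the boundary of a convex set *)

Definition dist (A : set V) x : R := fine (ereal_inf [set (enorm (x - y))%:E | y in A]).

Lemma dist_fin (A : set V) x : A !=set0 ->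
  ereal_inf [set (enorm (x - y))%:E | y in A] \is a fin_num.
Proof.
move=> [y Ay]; apply/fin_numPlt/andP; split.
  apply: (@lt_le_trans _ _ 0%E); first exact: ltNyr.
  by apply: le_ereal_inf_tmp => _ [z _ <-]; rewrite lee_fin enorm_ge0.
apply: (@le_lt_trans _ _ (enorm (x - y))%:E); last exact: ltry.
by apply: ereal_inf_lbound; exists y.
Qed.

Lemma dist_le (A : set V) x y : A y -> dist A x <= enorm (x - y).
Proof.
move=> Ay; rewrite -lee_fin fineK; last by apply: dist_fin; exists y.
by apply: ereal_inf_lbound; exists y.
Qed.

Lemma dist_ge (A : set V) x k : A !=set0 ->
  (forall y, A y -> k <= enorm (x - y)) -> k <= dist A x.
Proof.
move=> A0 kA; rewrite -lee_fin fineK; last exact: dist_fin.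
by apply: le_ereal_inf_tmp => _ [z Az <-]; rewrite lee_fin kA.
Qed.

Lemma dist_lipschitz (A : set V) x y : A !=set0 -> dist A x - dist A y <= enorm (x - y).
Proof.
move=> A0; rewrite lerBlDr -lerBlDl; apply: dist_ge => // z Az.
by have := dist_le x Az; have := enorm_dist x y z; lra.
Qed.

Lemma dist_continuous (A : set V) : A !=set0 -> continuous (dist A).
Proof.
by move=> A0; apply: (@lipschitz_continuous _ 1) => x y; rewrite mul1r dist_lipschitz.
Qed.

(** Points of A that are farther away than a given one do not matter, and the
    others form a compact set. *)
Lemma dist_attained (A : set V) x : A !=set0 -> closed A ->
  exists2 y, A y & dist A x = enorm (x - y).
Proof.
move=> A0 cA; have [y0 Ay0] := A0.
have cf : continuous (fun y => enorm (x - y)).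
  apply: (@lipschitz_continuous _ 1) => y z; rewrite mul1r.
  by have := enorm_dist x z y; rewrite (enormB z y); lra.
pose K := A `&` [set y | enorm (x - y) <= enorm (x - y0)].
have cK : compact K.
  apply: bounded_closed_compact.
    exists (`|x| + enorm (x - y0)); split; first exact: num_real.
    move=> r rM y [_ /= yM]; apply: le_trans (ltW rM).
    have := norm_le_enorm (x - y); have := ler_normB x (x - y).
    by rewrite subKr; lra.
  apply: closedI => //.
  apply: (@closed_comp _ _ (fun y => enorm (x - y)) [set r | r <= enorm (x - y0)]).
    by move=> z _; exact: cf.
  exact: closed_le.
have K0 : K !=set0 by exists y0; split => //=.
have [y Ky yK] := compact_EVT_min K0 cK (continuous_subspaceT cf).
move: Ky; rewrite inE => -[Ay yx]; exists y => //; apply/eqP; rewrite eq_le.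
rewrite dist_le//=; apply: dist_ge => // z Az.
have [zx|zx] := leP (enorm (x - z)) (enorm (x - y0)).
  by apply: yK; rewrite inE; split.
by apply: le_trans yx _; exact: ltW.
Qed.

End euclid.

Section convex_distance.
Context {R : realType} {n : nat}.
Notation V := 'rV[R]_n.
Variable Omega : set V.
Hypotheses (oO : open Omega) (cO : convex_set Omega).
Hypothesis bO : boundary Omega !=set0.
Notation d := (dist (boundary Omega)).

Lemma boundary_notin y : boundary Omega y -> ~ Omega y.
Proof. by move=> [_ ny] Oy; apply: ny; move/interior_id : oO => ->. Qed.

Lemma closed_boundary : closed (boundary Omega).
Proof.
apply: closedI; first exact: closed_closure.
by rewrite closedC; exact: open_interior.
Qed.

(** The supremum of the parameters at which the segment is still in Omega. *)
Lemma segment_boundary x q : Omega x -> ~ Omega q ->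
  exists2 t, 0 <= t <= 1 & boundary Omega (x + t *: (q - x)).
Proof.
move=> Ox nOq.
pose g (t : R) : V := x + t *: (q - x).
have cg : continuous g.
  by move=> t; apply: cvgD; [exact: cvg_cst|apply: cvgZr_tmp; exact: cvg_id].
pose S := [set t | 0 <= t <= 1 /\ Omega (g t)].
have S0 : S 0 by split; rewrite ?lexx ?ler01// /g scale0r addr0.
have Sub : ubound S 1 by move=> t [/andP[]].
have hS : has_sup S by split; [exists 0|exists 1].
have s01 : 0 <= sup S <= 1.
  by apply/andP; split; [apply: ub_le_sup => //; exists 1|apply: ge_sup => //; exists 0].
exists (sup S) => //; split.
  move=> B /cg/nbhs_normP[e /= e0 eB].
  have [t St te] := sup_adherent e0 hS.
  exists (g t); split; first by case: St.
  apply: eB => /=; rewrite ger0_norm; first lra.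
  by rewrite subr_ge0; apply: ub_le_sup => //; exists 1.
move=> /interior_subset Os.
have s1 : sup S < 1.
  have /andP[_] := s01; rewrite le_eqVlt => /predU1P[s1|//].
  by move: Os; rewrite s1 scale1r addrCA subrr addr0.
have /cg/nbhs_normP[e /= e0 eO] : nbhs (g (sup S)) Omega by exact: open_nbhs_nbhs.
pose t := Num.min (sup S + e / 2) 1.
have st : sup S < t by rewrite lt_min s1 andbT ltrDl divr_gt0.
have : S t.
  split; first by rewrite (le_trans _ (ltW st)) ?ge_min ?lexx ?orbT//; case/andP: s01.
  apply: eO => /=; rewrite distrC ger0_norm; last by rewrite subr_ge0 ltW.
  have : t <= sup S + e / 2 by rewrite ge_min lexx.
  by lra.
by move=> /(ub_le_sup (ex_intro _ 1 Sub)); rewrite leNgt st.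
Qed.

Lemma dist_le_out x q : Omega x -> ~ Omega q -> d x <= enorm (x - q).
Proof.
move=> Ox nOq; have [t /andP[t0 t1] bt] := segment_boundary Ox nOq.
apply: le_trans (dist_le x bt) _.
rewrite opprD addrA subrr add0r enormN enormZ (enormB q) ger0_norm//.
by rewrite ler_piMl// enorm_ge0.
Qed.

Lemma dist_gt0 x : Omega x -> 0 < d x.
Proof.
move=> Ox; have [y By ->] := dist_attained x bO closed_boundary.
rewrite lt_neqAle enorm_ge0 andbT eq_sym; apply/negP => /eqP /enorm_eq0/eqP.
by rewrite subr_eq0 => /eqP xy; apply: (boundary_notin By); rewrite -xy.
Qed.

(** Let y be a boundary point nearest to x and p the unit vector from y to x. If
    some z in Omega had p . (z - y) < 0, then slightly beyond y on the line from
    z there would be a point of the ball of radius d x around x, hence of Omega,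
    and y would lie in Omega by convexity. So Omega lies in the half-space p .
    (z - y) >= 0, and a point of Omega is at most as far from the complement of
    Omega as from the bounding hyperplane. *)
Lemma dist_supergradient x : Omega x ->
  exists2 p, enorm p = 1 & forall x', Omega x' -> d x' <= d x + dot p (x' - x).
Proof.
move=> Ox; have D0 := dist_gt0 Ox.
have [y By dE] := dist_attained x bO closed_boundary.
set D := enorm (x - y) in dE; rewrite dE in D0 *.
have Dn0 : D != 0 by rewrite gt_eqF.
pose p := D^-1 *: (x - y).
have p1 : enorm p = 1 by rewrite enormZ gtr0_norm ?invr_gt0// mulVf.
have px : dot p (x - y) = D by rewrite dotZl -enorm_sqr -/D expr2 mulKf.
have half z : Omega z -> 0 <= dot p (z - y).
  move=> Oz; rewrite leNgt; apply/negP; rewrite dotZl pmulr_rlt0 ?invr_gt0// => a0.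
  set a := dot (x - y) (z - y) in a0.
  pose E := enorm (z - y).
  (* The squared distance from x to y - t (z - y) is D^2 + 2 t a + t^2 E^2, which is less
     than D^2 for this t. *)
  pose t := - a / (E ^+ 2 + 1).
  have E1 : 0 < E ^+ 2 + 1 by rewrite ltr_wpDl// sqr_ge0.
  have t0 : 0 < t by rewrite divr_gt0// oppr_gt0.
  pose q := y - t *: (z - y).
  have Oq : Omega q.
    apply: contrapT => nOq; have := dist_le_out Ox nOq; rewrite dE.
    apply/negP; rewrite -ltNge -(@ltr_pXn2r _ 2)// ?nnegrE ?enorm_ge0//.
    have -> : x - q = (x - y) + t *: (z - y) by rewrite /q opprD opprK addrA.
    rewrite enorm_sqrD -/D -/E -/a.
    have tE : t * (E ^+ 2 + 1) = - a by rewrite /t divfK// gt_eqF.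
    have : t * (2 * a + t * E ^+ 2) < 0 by rewrite pmulr_rlt0//; lra.
    by move: (E ^+ 2) (D ^+ 2) => EE DD; lra.
  apply: (boundary_notin By).
  have t1 : 0 < 1 + t by rewrite addr_gt0.
  have l0 : 0 <= (1 + t)^-1 by rewrite invr_ge0 ltW.
  have l1 : (1 + t)^-1 <= 1 by rewrite invf_le1// lerDl ltW.
  have := @cO q z (Itv01 l0 l1) (mem_set Oq) (mem_set Oz).
  rewrite inE /conv/=.
  rewrite (_ : _ + _ = y)//.
  apply/rowP => i; rewrite /q /unstable.onem !mxE; field; exact: lt0r_neq0.
exists p => // x' Ox'.
have -> : D + dot p (x' - x) = dot p (x' - y).
  by rewrite -px -dotDr addrC addrA subrK.
apply/ler_addgt0Pr => e e0; set s := dot p (x' - y).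
have s0 : 0 <= s by exact: half.
(* q is at distance e beyond the hyperplane, hence outside Omega. *)
pose q := x' - (s + e) *: p.
have nOq : ~ Omega q.
  move=> /half; rewrite /q addrAC dotDr dotNr dotZr -enorm_sqr p1 -/s; lra.
apply: le_trans (dist_le_out Ox' nOq) _.
by rewrite /q opprD addrA subrr add0r opprK enormZ p1 mulr1 ger0_norm//; lra.
Qed.

End convex_distance.

(** * Taylor bound and directional derivatives *)

Section taylor.
Context {R : realType}.
Variables (Phi G w : R -> R) (D1 : R).
Hypothesis dPhi : forall t, 0 < t < D1 -> is_derive t 1 Phi (G t).
Hypothesis dG : forall t, 0 < t < D1 -> is_derive t 1 G (- w t).

(** The derivative of Phi (y) - G (t) (y - t) + c (y - t)^2 / 2 weakly has the
    sign of t - y between t and t + s. *)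
Lemma taylor2_le t s c : 0 < t < D1 -> 0 < t + s < D1 ->
  (forall y, `|y - t| <= `|s| -> 0 < y < D1 -> c <= w y) ->
  Phi (t + s) <= Phi t + s * G t - s ^+ 2 / 2 * c.
Proof.
move=> /andP[t0 t1] /andP[ts0 ts1] cw.
(* chi is the derivative of psi, and vanishes at t. *)
pose psi (y : R) := Phi y - G t * (y - t) + c / 2 * ((y - t) * (y - t)).
pose chi (y : R) := G y - G t + c * (y - t).
have dyt (y : R) : is_derive y 1 (fun z : R => z - t) 1.
  by apply: is_derive_eq (deriveRD (deriveR_id y) (deriveRN (deriveR_cst t y))) _; lra.
have dpsi (y : R) : 0 < y < D1 -> is_derive y 1 psi (chi y).
  move=> y01; apply: is_derive_eq (deriveRD (deriveRD (dPhi y01)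
    (deriveRN (deriveRM (deriveR_cst (G t) y) (dyt y))))
    (deriveRM (deriveR_cst (c / 2) y) (deriveRM (dyt y) (dyt y)))) _.
  by rewrite /chi; field.
have dchi (y : R) : 0 < y < D1 -> is_derive y 1 chi (c - w y).
  move=> y01; apply: is_derive_eq (deriveRD (deriveRD (dG y01)
    (deriveRN (deriveR_cst (G t) y))) (deriveRM (deriveR_cst c y) (dyt y))) _.
  by ring.
have wi (F dF : R -> R) (l u : R) : 0 < l -> u < D1 ->
    (forall y : R, 0 < y < D1 -> is_derive y 1 F (dF y)) ->
    {within `[l, u], continuous F}.
  move=> l0 u1 dFy; apply: continuous_in_subspaceT => y.
  rewrite inE/= in_itv/= => /andP[ly yu].
  by apply: deriveR_continuous (dFy y _); apply/andP; split; lra.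
have chit : chi t = 0 by rewrite /chi !subrr mulr0 addr0.
have mv (F dF : R -> R) (l u : R) : 0 < l -> u < D1 -> l < u ->
    (forall y : R, 0 < y < D1 -> is_derive y 1 F (dF y)) ->
    exists2 y, l < y < u & F u - F l = dF y * (u - l).
  move=> l0 u1 lu dFy.
  have dFlu (y : R) : y \in `]l, u[ -> is_derive y 1 F (dF y).
    by rewrite in_itv/= => /andP[ly yu]; apply: dFy; apply/andP; split; lra.
  have [y] := MVT lu dFlu (wi F dF l u l0 u1 dFy).
  by rewrite in_itv/= => ylu E; exists y.
suff : psi (t + s) <= psi t.
  have st : t + s - t = s by ring.
  by rewrite /psi subrr st; lra.
have [s0|s0|s0] := ltgtP s 0; last by rewrite s0 addr0.
- have [y /andP[y1 y2] E] := mv psi chi (t + s) t ts0 t1 ltac:(lra) dpsi.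
  have [z /andP[z1 z2] E2] := mv chi _ y t ltac:(lra) t1 y2 dchi.
  have cz : c <= w z by apply: cw; [rewrite !ltr0_norm; lra|apply/andP; split; lra].
  have : 0 <= chi y by rewrite chit in E2; nra.
  by nra.
- have [y /andP[y1 y2] E] := mv psi chi t (t + s) t0 ts1 ltac:(lra) dpsi.
  have [z /andP[z1 z2] E2] := mv chi _ t y t0 ltac:(lra) y1 dchi.
  have cz : c <= w z by apply: cw; [rewrite !gtr0_norm; lra|apply/andP; split; lra].
  have : chi y <= 0 by rewrite chit in E2; nra.
  by nra.
Qed.

End taylor.

Section partial_derivatives.
Context {R : realType} {n : nat}.
Notation V := 'rV[R]_n.
Implicit Types (f : V -> R) (x v : V).

(** The difference quotients of f along v and those of its restriction to the
    line are the same functions. *)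
Lemma is_derive_line f x v (t : R) : differentiable f (x + t *: v) ->
  is_derive t 1 (fun s : R => f (x + s *: v)) ('D_v f (x + t *: v)).
Proof.
move=> df; have dv : derivable f (x + t *: v) v by exact: diff_derivable.
have E : (fun h : R => h^-1 *: (((fun s : R => f (x + s *: v)) \o shift t) (h *: (1 : R)) - f (x + t *: v)))
   = (fun h : R => h^-1 *: ((f \o shift (x + t *: v)) (h *: v) - f (x + t *: v))).
  apply/funext => h /=; rewrite -[h *: 1]/(h * 1) mulr1 scalerDl.
  by rewrite addrCA.
by split; rewrite /derivable /derive E.
Qed.

Lemma partial_mvt f x v : (forall t, 0 <= t <= 1 -> differentiable f (x + t *: v)) ->
  exists2 t, 0 <= t <= 1 & f (x + v) - f x = 'D_v f (x + t *: v).
Proof.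
move=> df.
pose g (s : R) := f (x + s *: v).
have dg (t : R) : t \in `]0, 1[ -> is_derive t 1 g ('D_v f (x + t *: v)).
  by rewrite in_itv/= => /andP[t0 t1]; apply: is_derive_line; apply: df; rewrite !ltW.
have cg : {within `[0, 1], continuous g}.
  apply: continuous_in_subspaceT => t; rewrite inE/= in_itv/= => t01.
  by apply: deriveR_continuous (is_derive_line (df t t01)).
have [t] := MVT ltr01 dg cg.
rewrite /g in_itv/= => /andP[t0 t1]; rewrite scale1r scale0r addr0 subr0 mulr1 => E.
by exists t; rewrite ?ltW.
Qed.

Lemma deriveZ_dir f x (k : R) v : differentiable f x -> 'D_(k *: v) f x = k * 'D_v f x.
Proof. by move=> df; rewrite !deriveE// linearZ. Qed.

End partial_derivatives.

(** * Extension by zero and cutoff functions *)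

Section extension.
Context {R : realType} {n : nat}.
Notation V := 'rV[R]_n.
Variables (Omega : set V) (f : V -> R).
Hypotheses (oO : open Omega) (fC : C1_compact Omega f).

Definition csupp : set V := closure [set x | Omega x /\ f x != 0].

(** The values of f outside Omega are arbitrary, and the translates of an
    integrand leave Omega. *)
Definition extend0 (phi : V -> R) x : R := if `[< Omega x >] then phi x else 0.

Lemma extend0E phi x : Omega x -> extend0 phi x = phi x.
Proof. by move=> Ox; rewrite /extend0 asboolT. Qed.

Lemma extend0_out phi x : ~ Omega x -> extend0 phi x = 0.
Proof. by move=> Ox; rewrite /extend0 asboolF. Qed.

Lemma csupp_compact : compact csupp.
Proof. by have [_ _ []] := fC. Qed.

Lemma csupp_sub : csupp `<=` Omega.
Proof. by have [_ _ []] := fC. Qed.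

Lemma csupp_out x : Omega x -> ~ csupp x -> f x = 0.
Proof.
move=> Ox nK; apply/eqP; apply: contra_notT nK => fx.
exact: (@subset_closure _ [set x | Omega x /\ f x != 0] x (conj Ox fx)).
Qed.

Lemma closed_csupp : closed csupp.
Proof. exact: closed_closure. Qed.

(** Near a point outside Omega the extension vanishes, because the support is
    closed and contained in Omega. *)
Lemma Cc_extend0 phi : (forall x, Omega x -> {for x, continuous phi}) ->
  (forall x, Omega x -> ~ csupp x -> phi x = 0) -> Cc (extend0 phi).
Proof.
move=> cphi phi0.
have ext0 x : ~ csupp x -> extend0 phi x = 0.
  by move=> nK; have [Ox|Ox] := pselect (Omega x); [rewrite extend0E// phi0|rewrite extend0_out].
have cext (x : V) : {for x, continuous (extend0 phi)}.
  have [Ox|Ox] := pselect (Omega x).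
    move=> B; rewrite extend0E// => /(cphi x Ox) cB.
    have {}cB : nbhs x (phi @^-1` B) by [].
    have OO : nbhs x Omega by exact: open_nbhs_nbhs.
    apply: (filterS _ (filterI cB OO)).
    by move=> y [By Oy]; rewrite /= extend0E.
  have nK : ~ csupp x by move=> /csupp_sub.
  have OK : nbhs x (~` csupp).
    by apply: open_nbhs_nbhs; split=> //; rewrite openC; exact: closed_csupp.
  move=> B; rewrite extend0_out// => B0.
  apply: (filterS _ OK) => y /= nKy.
  by rewrite /= ext0//; exact: nbhs_singleton.
split; first exact: cext.
have [M [_ HM]] := compact_bounded csupp_compact.
exists (M + 1) => x Mx; apply: ext0 => Kx.
by have := HM (M + 1) ltac:(by rewrite ltrDl) x Kx; rewrite /= leNgt Mx.
Qed.

Definition basis_vec (i : 'I_n) : V := delta_mx ord0 i.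

Definition abs_ext := extend0 (fun x => `|f x|).
Definition partial_ext i := extend0 ('D_(basis_vec i) f).
Definition grad_norm_ext := extend0 (fun x => enorm (grad f x)).

Lemma Cc_abs_ext : Cc abs_ext.
Proof.
apply: Cc_extend0 => x Ox; last by move=> nK; rewrite csupp_out// normr0.
have [df _ _] := fC.
by apply: continuous_comp; [exact/differentiable_continuous/df|exact: norm_continuous].
Qed.

Lemma csupp_derive_out i x : Omega x -> ~ csupp x -> 'D_(basis_vec i) f x = 0.
Proof.
move=> Ox nK.
have OK : nbhs x (Omega `&` ~` csupp).
  apply: open_nbhs_nbhs; split=> //; apply: openI => //.
  by rewrite openC; exact: closed_csupp.
rewrite (near_eq_derive (g := cst 0)) ?derive_cst//.
by apply: (filterS _ OK) => y [Oy nKy]; rewrite csupp_out.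
Qed.

Lemma gradE x i : grad f x ord0 i = 'D_(basis_vec i) f x.
Proof. by rewrite mxE. Qed.

Lemma Cc_partial_ext i : Cc (partial_ext i).
Proof.
apply: Cc_extend0 => x Ox; last exact: csupp_derive_out.
have [_ cg _] := fC.
rewrite (_ : 'D_(basis_vec i) f = (fun M : V => M ord0 i) \o grad f); last first.
  by apply/funext => y /=; rewrite gradE.
by apply: continuous_comp; [exact: cg|exact: coord_continuous].
Qed.

Lemma csupp_grad_out x : Omega x -> ~ csupp x -> grad f x = 0.
Proof.
by move=> Ox nK; apply/rowP => i; rewrite gradE csupp_derive_out// mxE.
Qed.

Lemma Cc_grad_norm_ext : Cc grad_norm_ext.
Proof.
apply: Cc_extend0 => x Ox.
  have [_ cg _] := fC.
  by apply: continuous_comp; [exact: cg|exact: enorm_continuous].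
by move=> nK; rewrite csupp_grad_out// enorm0.
Qed.

Lemma grad_norm_extE x : grad_norm_ext x = enorm (\row_i partial_ext i x).
Proof.
have [Ox|Ox] := pselect (Omega x).
  rewrite /grad_norm_ext extend0E//; congr enorm; apply/rowP => i.
  by rewrite gradE mxE /partial_ext extend0E.
rewrite /grad_norm_ext extend0_out// (_ : (\row_i _) = 0) ?enorm0//.
by apply/rowP => i; rewrite !mxE /partial_ext extend0_out.
Qed.

Lemma enorm_basis_vec i : enorm (basis_vec i) = 1.
Proof.
rewrite /enorm (bigD1 i)//= mxE !eqxx expr1n big1 ?addr0 ?sqrtr1// => j ji.
by rewrite mxE (negPf ji) andbF expr0n.
Qed.

Lemma dot_basis_vec p i : dot p (basis_vec i) = p ord0 i.
Proof.
rewrite /dot (bigD1 i)//= mxE !eqxx mulr1 big1 ?addr0// => j ji.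
by rewrite mxE (negPf ji) andbF mulr0.
Qed.

End extension.

Section cutoff.
Context {R : realType} {n : nat}.
Notation V := 'rV[R]_n.
Variable K : set V.
Hypotheses (K0 : K !=set0) (cK : compact K).
Notation dK := (dist K).

(** Summing the second differences of the potential by parts against a Lipschitz
    cutoff bounds their total mass. *)
Definition cutoff (s : R) x : R := Num.max 0 (Num.min 1 (2 - dK x / s)).

Lemma cutoff_ge0 s x : 0 <= cutoff s x.
Proof. by rewrite /cutoff le_max lexx. Qed.

Lemma cutoff_eq1 s x : 0 < s -> dK x <= s -> cutoff s x = 1.
Proof.
move=> s0 xs; have : dK x / s <= 1 by rewrite ler_pdivrMr// mul1r.
move=> h; rewrite /cutoff min_l; last by lra.
by rewrite max_r.
Qed.

Lemma cutoff_eq0 s x : 0 < s -> 2 * s <= dK x -> cutoff s x = 0.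
Proof.
move=> s0 xs; have : 2 <= dK x / s by rewrite ler_pdivlMr.
move=> h; rewrite /cutoff max_l// ge_min; apply/orP; right; lra.
Qed.

Lemma cutoff_lipschitz s x y : 0 < s -> cutoff s x - cutoff s y <= enorm (x - y) / s.
Proof.
move=> s0; have h : dK y / s - dK x / s <= enorm (x - y) / s.
  by rewrite -mulrBl ler_wpM2r ?invr_ge0 ?(ltW s0)// enormB dist_lipschitz.
have h0 : 0 <= enorm (x - y) / s by rewrite divr_ge0 ?enorm_ge0 ?(ltW s0).
rewrite /cutoff lerBlDr.
move: (dK x / s) (dK y / s) (enorm _ / s) h h0 => a b c h h0.
have le_min_c : Num.min 1 (2 - a) <= c + Num.min 1 (2 - b).
  rewrite addr_minr le_min !ge_min; apply/andP; split; apply/orP; [left|right]; lra.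
rewrite addr_maxr ge_max !le_max le_min_c orbT andbT; apply/orP; left; lra.
Qed.

Lemma dist_mem x : K x -> dK x = 0.
Proof.
move=> Kx; apply/eqP; rewrite eq_le; apply/andP; split.
  by have := dist_le x Kx; rewrite subrr enorm0.
by apply: dist_ge => // y _; exact: enorm_ge0.
Qed.

Lemma Cc_cutoff s : 0 < s -> Cc (cutoff s).
Proof.
move=> s0; split.
  by apply: (@lipschitz_continuous _ _ _ s^-1) => x y; rewrite mulrC cutoff_lipschitz.
have [M [_ HM]] := compact_bounded cK.
exists (M + 1 + 2 * s) => x Mx; apply: cutoff_eq0 => //; apply: dist_ge => // y Ky.
have := HM (M + 1) ltac:(by rewrite ltrDl) y Ky => /= yM.
by have := norm_le_enorm (x - y); have := ler_normD y (x - y); rewrite addrC subrK; lra.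
Qed.

End cutoff.

(** * The weighted Hardy inequality on convex sets *)

Section hardy.
Context {R : realType} {n : nat}.
Notation V := 'rV[R]_n.
Variables (Omega : set V) (f : V -> R).
Hypotheses (oO : open Omega) (cO : convex_set Omega).
Hypotheses (bO : boundary Omega !=set0) (fC : C1_compact Omega f).
Notation d := (dist (boundary Omega)).
Notation K := (csupp Omega f).
Notation dK := (dist K).
Hypothesis K0 : K !=set0.

(* D1 > D0 leaves room for the values d x + p . (z - x) of the affine majorants. *)
Variables (Phi G w : R -> R) (D0 D1 : R).
Hypothesis D01 : D0 < D1.
Hypothesis dD0 : forall x, Omega x -> d x <= D0.
Hypothesis dPhi : forall t, 0 < t < D1 -> is_derive t 1 Phi (G t).
Hypothesis dG : forall t, 0 < t < D1 -> is_derive t 1 G (- w t).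
Hypothesis w_ge0 : forall t, 0 < t < D1 -> 0 <= w t.
Hypothesis G_ge0 : forall t, 0 < t < D1 -> 0 <= G t.
Hypothesis w_cont : forall t, 0 < t < D1 -> {for t, continuous w}.

Let cK : compact K := csupp_compact fC.
Let dK_mem := @dist_mem _ _ K K0.

(** The distance to the boundary has a positive minimum on the compact support.
    *)
Lemma support_margin : exists2 e, 0 < e & forall x, K x -> e <= d x.
Proof.
have cd := dist_continuous bO.
have [x Kx xmin] := compact_EVT_min K0 cK (continuous_subspaceT cd).
exists (d x); last by move=> y Ky; apply: xmin; rewrite inE.
by apply: dist_gt0 => //; apply: (csupp_sub fC); move: Kx; rewrite inE.
Qed.

Variable e : R.
Hypotheses (e0 : 0 < e) (Ke : forall x, K x -> e <= d x).

(** A point x at distance less than e from a point k of the support is in Omega,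
    since d k >= e is at most the distance from k to any point outside Omega. *)
Lemma near_support x s : dK x <= s -> s < e -> Omega x /\ e - s <= d x.
Proof.
move=> xs se; have [k Kk xk] := dist_attained x K0 (closed_csupp (f := f)).
have xks : enorm (k - x) <= s by rewrite enormB -xk.
have := Ke Kk => ek; split.
  apply: contrapT => nOx.
  by have := dist_le_out oO (csupp_sub fC Kk) nOx; lra.
by have := dist_lipschitz k x bO; lra.
Qed.

(* Points within 4 rho of the support are in Omega and have d >= a; the steps are at
   most rho, and second differences are taken within 2 rho of the support. *)
Let rho := e / 8.
Let a := e / 2.
Let b := (D0 + D1) / 2.

Lemma eD0 : e <= D0.
Proof.
have [k Kk] := K0; apply: le_trans (Ke Kk) (dD0 (csupp_sub fC Kk)).
Qed.

Definition clamp (t : R) : R := Num.max a (Num.min t b).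

Lemma clamp_itv t : a <= clamp t <= b.
Proof.
have := eD0; have := e0; have := D01; rewrite /clamp /a /b => h1 h2 h3.
rewrite le_max lexx/= ge_max ge_min lexx orbT andbT; lra.
Qed.

Lemma clamp_dom t : 0 < clamp t < D1.
Proof.
have /andP[] := clamp_itv t; have := eD0; have := e0; have := D01.
by rewrite /a /b => h1 h2 h3 h4 h5; apply/andP; split; lra.
Qed.

Lemma clampE t : a <= t <= D0 -> clamp t = t.
Proof.
move=> /andP[at_ tD]; have := D01 => h.
by rewrite /clamp min_l ?max_r// /b; lra.
Qed.

Lemma clamp_lipschitz s t : clamp s - clamp t <= `|s - t|.
Proof.
have h : s - t <= `|s - t| := ler_norm _.
have h0 : 0 <= `|s - t| by [].
move: (`|s - t|) h h0 => c h h0; rewrite lerBlDr /clamp.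
have le_min_c : Num.min s b <= c + Num.min t b.
  by rewrite addr_minr le_min !ge_min; apply/andP; split; apply/orP; [left|right]; lra.
by rewrite addr_maxr ge_max !le_max le_min_c orbT andbT; apply/orP; left; lra.
Qed.

Lemma continuous_clamp_comp (F : R -> R) :
  (forall t, 0 < t < D1 -> {for t, continuous F}) ->
  continuous (fun x : V => F (clamp (d x))).
Proof.
move=> cF x; apply: (@continuous_comp _ _ _ (fun x : V => clamp (d x)) F).
  apply: (@lipschitz_continuous _ _ _ 1) => y z; rewrite mul1r.
  apply: le_trans (clamp_lipschitz _ _) _; rewrite ler_norml lerNl opprB.
  by rewrite dist_lipschitz// enormB dist_lipschitz.
by apply: cF; exact: clamp_dom.
Qed.

Let cPhi t : 0 < t < D1 -> {for t, continuous Phi}.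
Proof. by move=> t01; exact: deriveR_continuous (dPhi t01). Qed.

Let cG t : 0 < t < D1 -> {for t, continuous G}.
Proof. by move=> t01; exact: deriveR_continuous (dG t01). Qed.

Definition potential (x : V) : R := Phi (clamp (d x)).

Lemma potential_continuous : continuous potential.
Proof. exact: (continuous_clamp_comp cPhi). Qed.

(** Phi is concave, as w >= 0. *)
Lemma Phi_tangent s t : 0 < s < D1 -> 0 < t < D1 -> Phi t <= Phi s + (t - s) * G s.
Proof.
move=> s01 t01; have ts : s + (t - s) = t by ring.
have := taylor2_le (Phi := Phi) (G := G) (w := w) (D1 := D1) (c := 0) dPhi dG s01.
move=> /(_ (t - s)); rewrite ts mulr0 subr0; apply => // y _; exact: w_ge0.
Qed.

Lemma Phi_nondecreasing s t : 0 < s -> s <= t -> t < D1 -> Phi s <= Phi t.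
Proof.
move=> s0 st tD; have t01 : 0 < t < D1 by apply/andP; split; lra.
have s01 : 0 < s < D1 by apply/andP; split; lra.
by have := Phi_tangent t01 s01; have := G_ge0 t01; nra.
Qed.

Lemma G_bound : exists2 C, 0 <= C & forall t, a <= t <= b -> G t <= C.
Proof.
have ab : a <= b by have /andP[h1 h2] := clamp_itv 0; exact: le_trans h1 h2.
have cGab : {within `[a, b], continuous G}.
  apply: continuous_in_subspaceT => t; rewrite inE/= in_itv/= => /andP[at_ tb].
  have := eD0; have := e0; have := D01; move: at_ tb; rewrite /a /b => *.
  by apply: cG; apply/andP; split; lra.
have [t _ Gt] := EVT_max ab cGab; exists `|G t| => // s sab.
by apply: le_trans (Gt s _) (ler_norm _); rewrite in_itv.
Qed.

(** G is bounded on the range of [clamp]. *)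
Lemma potential_lipschitz : exists2 C, 0 <= C & forall x y, `|potential x - potential y| <= C * enorm (x - y).
Proof.
have [C C0 GC] := G_bound; exists C => //.
suff H x y : potential x - potential y <= C * enorm (x - y).
  by move=> x y; rewrite ler_norml H andbT lerNl opprB enormB H.
have := Phi_tangent (clamp_dom (d y)) (clamp_dom (d x)); rewrite -/(potential x) -/(potential y) => h.
have G0 := G_ge0 (clamp_dom (d y)); have GC' := GC _ (clamp_itv (d y)).
have cl := clamp_lipschitz (d x) (d y).
have dl : `|d x - d y| <= enorm (x - y).
  by rewrite ler_norml lerNl opprB dist_lipschitz// enormB dist_lipschitz.
have m0 := enorm_ge0 (x - y).
apply: (@le_trans _ _ (enorm (x - y) * G (clamp (d y)))).
  rewrite lerBlDl (le_trans h)// lerD2l ler_wpM2r//; lra.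
by rewrite mulrC ler_wpM2r.
Qed.

Definition second_diff (h : R) i (x : V) : R :=
  potential x + potential x - potential (x + h *: basis_vec i) - potential (x - h *: basis_vec i).

Lemma enorm_scaled_basis_vec h i : 0 <= h -> enorm (h *: basis_vec i : V) = h.
Proof. by move=> h0; rewrite enormZ enorm_basis_vec mulr1 ger0_norm. Qed.

Lemma dK_shift x y : dK (x + y) <= dK x + enorm y.
Proof. by have := dist_lipschitz (x + y) x K0; rewrite addrAC subrr add0r; lra. Qed.

(** Along the unit supergradient p of d, put s = h p_i. Then d (x + h e_i) <= d
    x + s and d (x - h e_i) <= d x - s, so the potential at these points is at
    most Phi (d x + s) and Phi (d x - s). The tangent bound for Phi gives the
    first two inequalities, and the Taylor bound with remainder gives the third.
    *)
Lemma local_estimate x h : dK x <= 2 * rho -> 0 < h <= rho -> h < D1 - D0 ->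
  exists2 p, enorm p = 1 & forall i,
  [/\ 0 <= h * p ord0 i * G (d x) - (potential (x + h *: basis_vec i) - potential x),
      h * p ord0 i * G (d x) - (potential (x + h *: basis_vec i) - potential x) <= second_diff h i x &
      forall c, (forall y, `|y - d x| <= h -> 0 < y < D1 -> c <= w y) ->
        (h * p ord0 i) ^+ 2 * c <= second_diff h i x].
Proof.
move=> x2 /andP[h0 hr] hD.
have e8 : rho * 8 = e by rewrite /rho divfK.
have r0 : 0 < rho by rewrite /rho divr_gt0.
have [Ox xa] := near_support x2 ltac:(lra).
have xD := dD0 Ox.
have ux : potential x = Phi (d x) by rewrite /potential clampE// xD andbT /a; lra.
have [p p1 pP] := dist_supergradient oO cO bO Ox.
exists p => // i; set s := h * p ord0 i.
have sh : `|s| <= h.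
  rewrite /s normrM (gtr0_norm h0) ler_piMr ?(ltW h0)//.
  by rewrite -p1; exact: coord_le_enorm.
have /andP[s1 s2] : - h <= s <= h by rewrite -ler_norml.
have step (sg : R) : sg = 1 \/ sg = -1 -> let y := x + (sg * h) *: basis_vec i in
    0 < d x + sg * s < D1 /\ potential y <= Phi (d x + sg * s).
  move=> sg1 y.
  have ny : enorm ((sg * h) *: basis_vec i : V) = h.
    rewrite enormZ enorm_basis_vec mulr1 normrM (gtr0_norm h0).
    by case: sg1 => ->; rewrite ?normrN normr1 mul1r.
  have yK : dK y <= 3 * rho.
    by have := dK_shift x ((sg * h) *: basis_vec i); rewrite ny -/y; lra.
  have [Oy ya] := near_support yK ltac:(lra).
  have yD := dD0 Oy.
  have uy : potential y = Phi (d y) by rewrite /potential clampE// yD andbT /a; lra.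
  have ys : d y <= d x + sg * s.
    have := pP y Oy; rewrite /y addrAC subrr add0r dotZr dot_basis_vec.
    by rewrite /s mulrA.
  have ss : sg * s <= h by case: sg1 => ->; lra.
  have y0 : 0 < d y by lra.
  split; first by apply/andP; split; lra.
  by rewrite uy; apply: Phi_nondecreasing => //; lra.
have [dp up] := step 1 ltac:(by left).
have [dm um] := step (-1) ltac:(by right).
rewrite !mul1r in dp up; rewrite !mulN1r scaleNr in dm um.
have dx : 0 < d x < D1 by apply/andP; split; lra.
have tp := Phi_tangent dx dp; have tm := Phi_tangent dx dm.
rewrite -ux in tp tm.
rewrite /second_diff; split; [lra|lra|] => c wc.
have wcy y : `|y - d x| <= `|s| -> 0 < y < D1 -> c <= w y.
  by move=> ys y01; apply: wc => //; exact: le_trans ys sh.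
have qp := taylor2_le dPhi dG dx dp wcy.
have qm := taylor2_le dPhi dG dx dm (c := c).
have {}qm := qm ltac:(by rewrite normrN).
rewrite -ux in qp qm; move: qm; rewrite sqrrN; move: (s ^+ 2) qp => s2' qp qm; lra.
Qed.

Lemma abs_ext_mvt x h i : dK x <= rho -> 0 < h <= rho ->
  exists2 y, enorm (y - x) <= h &
  `|abs_ext Omega f (x + h *: basis_vec i) - abs_ext Omega f x| <= h * `|partial_ext Omega f i y|.
Proof.
move=> xr /andP[h0 hr].
have e8 : rho * 8 = e by rewrite /rho divfK.
have segO t : 0 <= t <= 1 -> Omega (x + t *: (h *: basis_vec i)) /\ enorm (t *: (h *: basis_vec i : V)) <= h.
  move=> /andP[t0 t1].
  have th : enorm (t *: (h *: basis_vec i : V)) <= h.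
    by rewrite enormZ enorm_scaled_basis_vec ?(ltW h0)// ger0_norm// ler_piMl// ltW.
  by split=> //; have [] := near_support (le_trans (dK_shift x _) (lerD xr th)) ltac:(lra).
have [df _ _] := fC.
have [t t01 E] := partial_mvt (f := f) (x := x) (v := h *: basis_vec i)
  (fun t t01 => df _ (segO t t01).1).
have [Oty hty] := segO t t01.
exists (x + t *: (h *: basis_vec i)); first by rewrite addrAC subrr add0r.
have [x1O _] := segO 1 ltac:(by rewrite ler01 lexx).
have [x0O _] := segO 0 ltac:(by rewrite lexx ler01).
rewrite scale1r in x1O; rewrite scale0r addr0 in x0O.
rewrite /abs_ext !extend0E//; apply: le_trans (ler_dist_dist _ _) _.
rewrite E deriveZ_dir; last exact: df.
by rewrite normrM (gtr0_norm h0) /partial_ext extend0E.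
Qed.

Lemma partial_le_grad_norm i x : `|partial_ext Omega f i x| <= grad_norm_ext Omega f x.
Proof.
by rewrite grad_norm_extE; have := coord_le_enorm (\row_i partial_ext Omega f i x) i; rewrite mxE.
Qed.

Lemma abs_ext_lipschitz : exists2 L, 0 <= L & forall x h i, dK x <= rho -> 0 < h <= rho ->
  `|abs_ext Omega f (x + h *: basis_vec i) - abs_ext Omega f x| <= h * L.
Proof.
have [L HL] := Cc_bounded (Cc_grad_norm_ext oO fC); exists `|L| => // x h i xr h0r.
have [y _ /le_trans] := abs_ext_mvt i xr h0r; apply; have /andP[h0 _] := h0r.
rewrite ler_wpM2l ?(ltW h0)//; apply: le_trans (partial_le_grad_norm _ _) _.
by apply: le_trans (ler_norm _) _; apply: le_trans (HL y) (ler_norm _).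
Qed.

Lemma abs_ext_quotient eta : 0 < eta -> exists2 r, 0 < r &
  forall x h i, dK x <= rho -> 0 < h <= rho -> h < r ->
  `|abs_ext Omega f (x + h *: basis_vec i) - abs_ext Omega f x| <= h * (`|partial_ext Omega f i x| + eta).
Proof.
move=> eta0.
have /choice[r rP] : forall i, exists r, 0 < r /\ forall x y : V, `|x - y| < r ->
    `|partial_ext Omega f i x - partial_ext Omega f i y| < eta.
  by move=> i; have [r r0 rP] := Cc_uniform (Cc_partial_ext oO fC i) eta0; exists r.
exists (\big[Num.min/1]_i r i).
  by apply/bigmin_gtP; split => // i _; have [] := rP i.
move=> x h i xr h0r hrr; have [y yx /le_trans] := abs_ext_mvt i xr h0r; apply.
have /andP[h0 _] := h0r; rewrite ler_wpM2l ?(ltW h0)//.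
have hri : h < r i by apply: lt_le_trans hrr _; exact: bigmin_le_cond.
have [_ /(_ y x)] := rP i => /(_ (le_lt_trans (le_trans (norm_le_enorm _) yx) hri)).
by have := ler_normD (partial_ext Omega f i x) (partial_ext Omega f i y - partial_ext Omega f i x); rewrite addrC subrK; lra.
Qed.

Notation chi := (cutoff K rho).
Notation psi := (cutoff K (3 * rho)).
Notation g := (abs_ext Omega f).
Notation N := (grad_norm_ext Omega f).

Let rho0 : 0 < rho. Proof. by rewrite /rho divr_gt0. Qed.
Let e8 : rho * 8 = e. Proof. by rewrite /rho divfK. Qed.

Lemma abs_ext_ge0 x : 0 <= g x.
Proof. by rewrite /abs_ext /extend0; case: asboolP. Qed.

Lemma abs_ext_out x : ~ K x -> g x = 0.
Proof.
move=> nK; have [Ox|Ox] := pselect (Omega x); last by rewrite /abs_ext extend0_out.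
by rewrite /abs_ext extend0E// (csupp_out Ox nK) normr0.
Qed.

Lemma grad_norm_ext_ge0 x : 0 <= N x.
Proof. by rewrite grad_norm_extE enorm_ge0. Qed.

Lemma dist_gt_out x : 0 < dK x -> ~ K x.
Proof. by move=> h /dK_mem E; rewrite E ltxx in h. Qed.

Lemma second_diff_ge0 x h i : dK x <= 2 * rho -> 0 < h <= rho -> h < D1 - D0 -> 0 <= second_diff h i x.
Proof.
move=> xr hr hD; have [p _ /(_ i)[h1 h2 _]] := local_estimate xr hr hD.
exact: le_trans h1 h2.
Qed.

(** Since p is a unit vector, the bounds (h p_i)^2 c of [local_estimate] add up
    to h^2 c. *)
Lemma sum_second_diff_ge eta x h : 0 < h <= rho -> h < D1 - D0 ->
  (forall y, `|y - d x| <= h -> 0 < y < D1 -> w (d x) - eta <= w y) ->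
  h ^+ 2 * (g x * w (clamp (d x)) - eta * g x) <= \sum_i g x * second_diff h i x.
Proof.
move=> hr hD we; have [Kx|nKx] := pselect (K x); last first.
  by rewrite abs_ext_out// !mul0r mulr0 subrr mulr0 big1// => i _; rewrite mul0r.
have xr : dK x <= 2 * rho by rewrite dK_mem// mulr_ge0// ltW.
have xD := dD0 (csupp_sub fC Kx).
have cl : clamp (d x) = d x by apply: clampE; have := Ke Kx; have := e0; rewrite xD andbT /a; lra.
have [p p1 pP] := local_estimate xr hr hD.
have -> : h ^+ 2 * (g x * w (clamp (d x)) - eta * g x) =
    g x * (h ^+ 2 * (w (d x) - eta)) by rewrite cl; ring.
rewrite -mulr_sumr ler_wpM2l ?abs_ext_ge0//.
have -> : h ^+ 2 * (w (d x) - eta) = \sum_i (h * p ord0 i) ^+ 2 * (w (d x) - eta).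
  rewrite -mulr_suml; congr (_ * _).
  under eq_bigr do rewrite exprMn.
  rewrite -mulr_sumr -[LHS]mulr1; congr (_ * _).
  by rewrite -[LHS](expr1n _ 2) -p1 enorm_sqr; apply: eq_bigr => i _; rewrite expr2.
by apply: ler_sum => i _; have [_ _] := pP i; apply.
Qed.

(** By [local_estimate] the difference of the potential is h p_i G (d x) up to
    an error of at most [second_diff]. The main terms are summed with the
    inequality of Cauchy and Schwarz for the vectors of absolute values; the
    cutoff function localizes the error terms. *)
Lemma sum_parts_le (L eta : R) (x : V) (h : R) : 0 < h <= rho -> h < D1 - D0 -> 0 <= eta ->
  (forall i, dK x <= rho -> `|g (x + h *: basis_vec i) - g x| <= h * L) ->
  (forall i, dK x <= rho ->
    `|g (x + h *: basis_vec i) - g x| <= h * (`|partial_ext Omega f i x| + eta)) ->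
  0 <= L ->
  \sum_i (g (x + h *: basis_vec i) - g x) * (potential (x + h *: basis_vec i) - potential x) <=
  h ^+ 2 * (N x * G (clamp (d x)) + n%:R * eta * (chi x * G (clamp (d x)))) +
  h * L * (\sum_i chi x * second_diff h i x).
Proof.
move=> hr hD eta0 gL ge L0; have /andP[h0 hrho] := hr.
have [r0 er e0'] : [/\ 0 < rho, rho * 8 = e & 0 < e] by [].
have Gc0 := G_ge0 (clamp_dom (d x)).
have [xr|xr] := leP (dK x) rho; last first.
  rewrite big1; last first.
    move=> i _; rewrite !abs_ext_out ?subrr ?mul0r//; apply: dist_gt_out.
      by apply: lt_trans xr.
    have := dist_lipschitz x (x + h *: basis_vec i) K0.
    by rewrite opprD addrA subrr add0r enormN enorm_scaled_basis_vec ?(ltW h0)//; lra.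
  apply: addr_ge0.
    apply: mulr_ge0; first exact: sqr_ge0.
    by rewrite addr_ge0// mulr_ge0 ?grad_norm_ext_ge0// mulr_ge0 ?cutoff_ge0.
  rewrite mulr_ge0//; first by rewrite mulr_ge0// ltW.
  apply: sumr_ge0 => i _; have [x2|x2] := leP (dK x) (2 * rho).
    by rewrite mulr_ge0 ?cutoff_ge0// second_diff_ge0.
  by rewrite cutoff_eq0 ?mul0r// ltW.
have x2 : dK x <= 2 * rho by lra.
have [Ox xa] := near_support xr ltac:(lra).
have cl : clamp (d x) = d x by apply: clampE; rewrite dD0// andbT /a; lra.
rewrite cl in Gc0 *; rewrite cutoff_eq1// mul1r.
have [p p1 pP] := local_estimate x2 hr hD.
pose q : V := \row_i `|partial_ext Omega f i x|; pose r : V := \row_i `|p ord0 i|.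
have q1 : enorm q = N x.
  rewrite grad_norm_extE /enorm; congr Num.sqrt; apply: eq_bigr => i _.
  by rewrite !mxE real_normK ?num_real.
have r1 : enorm r = 1.
  rewrite -p1 /enorm; congr Num.sqrt; apply: eq_bigr => i _.
  by rewrite !mxE real_normK ?num_real.
have ri i : 0 <= r ord0 i <= 1.
  by rewrite mxE normr_ge0/= -p1 coord_le_enorm.
apply: (@le_trans _ _ (\sum_i (h ^+ 2 * G (d x) * (q ord0 i * r ord0 i + eta) + h * L * second_diff h i x))).
  apply: ler_sum => i _; have [d1 d2 _] := pP i.
  have gLi := gL i xr; have gei := ge i xr; have /andP[ri0 ri1] := ri i.
  set Dg := g (x + h *: basis_vec i) - g x in gLi gei *.
  set Du := potential (x + h *: basis_vec i) - potential x in d1 d2 *.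
  have -> : Dg * Du = Dg * (h * p ord0 i * G (d x)) - Dg * (h * p ord0 i * G (d x) - Du) by ring.
  apply: lerD.
    apply: le_trans (ler_norm _) _; rewrite normrM.
    have -> : `|h * p ord0 i * G (d x)| = h * r ord0 i * G (d x).
      by rewrite !normrM mxE (gtr0_norm h0) (ger0_norm Gc0).
    apply: (@le_trans _ _ (h * (q ord0 i + eta) * (h * r ord0 i * G (d x)))).
      rewrite ler_wpM2r ?mulr_ge0 ?(ltW h0)// /q [in leRHS]mxE; exact: gei.
    have -> : h * (q ord0 i + eta) * (h * r ord0 i * G (d x)) =
      h ^+ 2 * G (d x) * (q ord0 i * r ord0 i + eta * r ord0 i) by ring.
    apply: ler_wpM2l; first by apply: mulr_ge0; [exact: sqr_ge0|].
    by apply: lerD => //; rewrite ler_piMr.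
  apply: (@le_trans _ _ (`|Dg| * (h * p ord0 i * G (d x) - Du))).
    by rewrite -mulNr ler_wpM2r// lerNl; have := ler_norm (- Dg); rewrite normrN; lra.
  by apply: ler_pM.
under [X in _ <= _ + _ * X]eq_bigr do rewrite mul1r.
rewrite big_split/= -!mulr_sumr lerD2r.
have S : \sum_i (q ord0 i * r ord0 i + eta) <= N x + n%:R * eta.
  rewrite big_split/= sumr_const card_ord mulr_natl lerD2r.
  by have := dot_le_enorm q r; rewrite q1 r1 mulr1.
have hG : 0 <= h ^+ 2 * G (d x) by apply: mulr_ge0; [exact: sqr_ge0|].
apply: (le_trans (ler_wpM2l hG S)); rewrite le_eqVlt; apply/orP; left.
by apply/eqP; ring.
Qed.

(** Both factors are O(h), and the first one vanishes at distance more than 3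
    rho from the support. *)
Lemma cutoff_parts_le C x h i : 0 < h <= rho -> 0 <= C ->
  (forall x y, `|potential x - potential y| <= C * enorm (x - y)) ->
  (chi (x + h *: basis_vec i) - chi x) * (potential (x + h *: basis_vec i) - potential x) <=
  h ^+ 2 * (C / rho * psi x).
Proof.
move=> /andP[h0 hr] C0 uC.
have r0 : 0 < rho by [].
have hh : enorm (x + h *: basis_vec i - x) = h by rewrite addrAC subrr add0r enorm_scaled_basis_vec ?(ltW h0).
have hh' : enorm (x - (x + h *: basis_vec i)) = h by rewrite enormB hh.
have [x3|x3] := leP (dK x) (3 * rho); last first.
  have c1 : chi x = 0 by apply: cutoff_eq0 => //; lra.
  have c2 : chi (x + h *: basis_vec i) = 0.
    apply: cutoff_eq0 => //.
    by have := dist_lipschitz x (x + h *: basis_vec i) K0; rewrite hh'; lra.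
  rewrite c1 c2 subrr mul0r; apply: mulr_ge0; first exact: sqr_ge0.
  by apply: mulr_ge0; [apply: divr_ge0 => //; exact: ltW|exact: cutoff_ge0].
rewrite (cutoff_eq1 _ x3) ?mulr1 ?mulr_gt0//.
apply: le_trans (ler_norm _) _; rewrite normrM.
have -> : h ^+ 2 * (C / rho) = (h / rho) * (C * h) by ring.
apply: ler_pM => //; last by apply: le_trans (uC _ _) _; rewrite hh.
rewrite ler_norml lerNl opprB; apply/andP; split.
  by apply: le_trans (cutoff_lipschitz K0 _ _ rho0) _; rewrite hh'.
by apply: le_trans (cutoff_lipschitz K0 _ _ rho0) _; rewrite hh.
Qed.

Let continuous_sub (F H : V -> R) :
  continuous F -> continuous H -> continuous (fun x => F x - H x).
Proof. by move=> cF cH x; apply: continuousB; [exact: cF|exact: cH]. Qed.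

Lemma Cc_second_diff phi h i : Cc phi -> Cc (fun x => phi x * second_diff h i x).
Proof.
move=> cphi; have uc := potential_continuous.
suff cl : continuous (second_diff h i) by exact: (Cc_mul cphi cl).
apply: continuous_sub; last exact: (continuous_translate (h := - (h *: basis_vec i)) uc).
apply: continuous_sub; last exact: (continuous_translate (h := h *: basis_vec i) uc).
by move=> x; apply: continuousD; exact: uc.
Qed.

Lemma Cc_diff_parts phi (v : V) : Cc phi ->
  Cc (fun x => (phi (x + v) - phi x) * (potential (x + v) - potential x)).
Proof.
move=> cphi; have uc := potential_continuous; apply: Cc_mul.
  rewrite (_ : (fun x => _) = (fun x => phi (x + v) + (-1) * phi x)).
    by apply: Cc_add; [exact: (Cc_comp_shift v cphi)|exact: Cc_scale].
  by apply/funext => x; rewrite mulN1r.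
by apply: continuous_sub => //; exact: (continuous_translate (h := v) uc).
Qed.

Let cKg : Cc g := Cc_abs_ext oO fC.
Let cKN : Cc N := Cc_grad_norm_ext oO fC.
Let cKchi s : 0 < s -> Cc (cutoff K s) := @Cc_cutoff _ _ _ K0 cK s.

Lemma w_uniform eta : 0 < eta -> exists2 r, 0 < r &
  forall s t, a <= s <= D0 -> `|s - t| < r -> w s - eta <= w t.
Proof.
move=> eta0; have [r r0 rP] : exists2 r, 0 < r & forall s t : R,
    `[a, b]%classic s -> `|s - t| < r -> `|w s - w t| < eta.
  apply: compact_uniform_continuous => //; first exact: segment_compact.
  move=> t; rewrite /= in_itv/= => /andP[at_ tb]; apply: w_cont.
  have := eD0; have := e0; have := D01; move: at_ tb; rewrite /a /b => *.
  by apply/andP; split; lra.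
exists r => // s t /andP[as_ sD] st.
have sab : `[a, b]%classic s.
  by rewrite /= in_itv/= as_/=; have := D01; rewrite /b; lra.
by have := rP s t sab st; rewrite ltr_norml => /andP[]; lra.
Qed.

(** After division by h^2 the inequality between the two sides of the summation
    by parts holds up to eta times M plus a multiple of h, where M depends
    neither on eta nor on h; taking h <= eta leaves an error of eta M. *)
Lemma hardy_clamped :
  integ (fun x => g x * w (clamp (d x))) <= integ (fun x => N x * G (clamp (d x))).
Proof.
have [C C0 uC] := potential_lipschitz; have [L L0 gL] := abs_ext_lipschitz.
have cw := continuous_clamp_comp w_cont; have cGc := continuous_clamp_comp cG.
have rho30 : 0 < 3 * rho by rewrite mulr_gt0.
have cgw : Cc (fun x => g x * w (clamp (d x))) by exact: Cc_mul.
have cNG : Cc (fun x => N x * G (clamp (d x))) by exact: (Cc_mul cKN cGc).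
have cchiG : Cc (fun x => chi x * G (clamp (d x))) by apply: Cc_mul => //; exact: cKchi.
have cpsi : Cc psi by exact: cKchi.
have cchi : Cc chi by exact: cKchi.
pose M : R := integ g + n%:R * integ (fun x => chi x * G (clamp (d x))) + L * (n%:R * (C / rho * integ psi)).
suff key eta : 0 < eta ->
    integ (fun x => g x * w (clamp (d x))) <= integ (fun x => N x * G (clamp (d x))) + eta * M.
  apply/ler_addgt0Pr => z z0.
  have M1 : 0 < `|M| + 1 by rewrite ltr_wpDl.
  apply: le_trans (key (z / (`|M| + 1)) (divr_gt0 z0 M1)) _; rewrite lerD2l.
  rewrite mulrAC ler_pdivrMr// ler_pM2l//.
  by apply: le_trans (ler_norm _) _; rewrite lerDl.
move=> eta0.
(* The step must respect the margin rho, stay below D1, and be small for the uniform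
   continuity of w and of the partial derivatives. *)
have [r1 r10 wr] := w_uniform eta0; have [r2 r20 gr] := abs_ext_quotient eta0.
have DD : 0 < (D1 - D0) / 2 by rewrite divr_gt0// subr_gt0.
pose h := Num.min (Num.min rho eta) (Num.min ((D1 - D0) / 2) (Num.min (r1 / 2) (r2 / 2))).
have h0 : 0 < h by rewrite !lt_min rho0 eta0 DD !divr_gt0.
have : h <= h by [].
rewrite {2}/h !le_min => /andP[/andP[hrho heta] /andP[hD /andP[hr1 hr2]]].
have hr : 0 < h <= rho by rewrite h0.
have hDD : h < D1 - D0 by lra.
have half (t : R) : 0 < t -> t / 2 < t.
  by move=> t0; rewrite ltr_pdivrMr// ltr_pMr// ltr1n.
have hr2' : h < r2 := le_lt_trans hr2 (half _ r20).
have h2 : 0 < h ^+ 2 by rewrite exprn_gt0.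
have A1 : h ^+ 2 * (integ (fun x => g x * w (clamp (d x))) - eta * integ g) <=
    integ (fun x => \sum_i g x * second_diff h i x).
  have c2 : Cc (fun x => - eta * g x) by exact: Cc_scale.
  rewrite -mulNr -integZ// -integD// -integZ; last exact: Cc_add.
  apply: le_integ; [apply: Cc_scale; exact: Cc_add|by apply: Cc_sum => i; exact: Cc_second_diff|].
  move=> x; rewrite mulNr.
  have [Kx|nKx] := pselect (K x); last first.
    by rewrite abs_ext_out// !mul0r mulr0 subrr mulr0 big1// => i _; rewrite mul0r.
  apply: sum_second_diff_ge => // y yh y01; apply: wr; last first.
    by rewrite distrC (le_lt_trans yh)//; lra.
  rewrite dD0 ?andbT; last exact: (csupp_sub fC).
  by have := Ke Kx; have := e0; rewrite /a; lra.
have A2 : integ (fun x => \sum_i g x * second_diff h i x) =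
    integ (fun x => \sum_i (g (x + h *: basis_vec i) - g x) * (potential (x + h *: basis_vec i) - potential x)).
  rewrite !integ_sum; last 2 first.
  - by move=> i; exact: Cc_diff_parts.
  - by move=> i; exact: Cc_second_diff.
  by apply: eq_bigr => i _; exact: (discrete_parts _ cKg potential_continuous).
have A4 i : integ (fun x => chi x * second_diff h i x) <= h ^+ 2 * (C / rho * integ psi).
  have -> : integ (fun x => chi x * second_diff h i x) = integ (fun x =>
      (chi (x + h *: basis_vec i) - chi x) * (potential (x + h *: basis_vec i) - potential x)).
    exact: (discrete_parts _ cchi potential_continuous).
  have c1 := Cc_scale (C / rho) cpsi.
  rewrite -(integZ (C / rho) cpsi) -(integZ (h ^+ 2) c1).
  apply: (le_integ (Cc_diff_parts _ cchi) (Cc_scale (h ^+ 2) c1)).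
  by move=> x; exact: cutoff_parts_le.
have A3 : integ (fun x => \sum_i (g (x + h *: basis_vec i) - g x) * (potential (x + h *: basis_vec i) - potential x)) <=
   h ^+ 2 * (integ (fun x => N x * G (clamp (d x))) +
      n%:R * eta * integ (fun x => chi x * G (clamp (d x)))) +
   h * L * \sum_i integ (fun x => chi x * second_diff h i x).
  have ck : Cc (fun x => n%:R * eta * (chi x * G (clamp (d x)))) by exact: Cc_scale.
  have cl i : Cc (fun x => chi x * second_diff h i x) by exact: Cc_second_diff.
  have cF1 := Cc_add cNG ck; have cF2 := Cc_sum cl.
  have cS : Cc (fun x => \sum_i (g (x + h *: basis_vec i) - g x) * (potential (x + h *: basis_vec i) - potential x)).
    by apply: Cc_sum => i; exact: Cc_diff_parts.
  rewrite -(integZ _ cchiG) -(integD cNG ck) -(integ_sum cl).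
  rewrite -(integZ _ cF1) -(integZ _ cF2) -(integD (Cc_scale _ cF1) (Cc_scale _ cF2)).
  apply: (le_integ cS (Cc_add (Cc_scale _ cF1) (Cc_scale _ cF2))).
  move=> x; apply: (sum_parts_le (L := L) (eta := eta) hr hDD (ltW eta0)) L0.
    by move=> i xr; exact: (gL x h i xr hr).
  by move=> i xr; exact: (gr x h i xr hr hr2').
(* The total mass of the second differences is O(h^2), so that the error term
   h L \sum_i ... below is O(h^3). *)
have A5 : \sum_i integ (fun x => chi x * second_diff h i x) <= h ^+ 2 * (n%:R * (C / rho * integ psi)).
  apply: (@le_trans _ _ (\sum_(i < n) h ^+ 2 * (C / rho * integ psi))).
    by apply: ler_sum => i _; exact: A4.
  by rewrite sumr_const card_ord -[leLHS]mulr_natl mulrCA lexx.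
rewrite A2 in A1; have {A1 A3 A2} A := le_trans A1 A3.
have P0 : 0 <= n%:R * (C / rho * integ psi).
  rewrite mulr_ge0// mulr_ge0//; first by rewrite divr_ge0// ltW.
  rewrite -(mul0r (integ psi)) -integZ//; apply: le_integ => //; first exact: Cc_scale.
  by move=> x; rewrite mul0r cutoff_ge0.
set B := n%:R * (C / rho * integ psi) in A5 P0 M *.
have A6 : h * L * \sum_i integ (fun x => chi x * second_diff h i x) <= h ^+ 2 * (eta * L * B).
  apply: (@le_trans _ _ (h * L * (h ^+ 2 * B))).
    by rewrite ler_wpM2l// mulr_ge0// ltW.
  rewrite mulrCA ler_wpM2l ?(ltW h2)//.
  by rewrite ler_wpM2r// ler_wpM2r.
have {A}A : h ^+ 2 * (integ (fun x => g x * w (clamp (d x))) - eta * integ g) <=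
  h ^+ 2 * (integ (fun x => N x * G (clamp (d x))) +
      n%:R * eta * integ (fun x => chi x * G (clamp (d x))) + eta * L * B).
  by rewrite [leRHS]mulrDr; apply: (le_trans A); rewrite lerD2l.
rewrite ler_pM2l// in A; rewrite /M; lra.
Qed.

End hardy.

(** * One-dimensional weights *)

Section weights.
Context {R : realType}.
Implicit Types A B D m eta t : R.

(** [weight_tail] is a primitive of minus [weight] with value eta at D, and
    [weight_potential] is a primitive of [weight_tail]. The constant eta > 0
    keeps [weight_tail] positive slightly beyond D, where the affine majorant of
    the distance function may take values. *)
Definition weight A B m t : R := A / t ^+ 2 + B / t `^ (2 - m).

Definition weight_tail A B D m eta t : R :=
  A * (t^-1 - D^-1) + B / (m - 1) * (D `^ (m - 1) - t `^ (m - 1)) + eta.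

Definition weight_potential A B D m eta t : R :=
  A * (ln t - t / D) + B / (m - 1) * (D `^ (m - 1) * t - t `^ m / m) + eta * t.

Lemma is_derive_weight_potential A B D m eta t : 1 < m -> 0 < t ->
  is_derive t 1 (weight_potential A B D m eta) (weight_tail A B D m eta t).
Proof.
move=> m1 t0; have m0 : m != 0 by rewrite gt_eqF// (lt_trans ltr01).
have di := deriveR_id t; have dk := deriveR_cst (R := R).
have dl : is_derive t 1 (@ln R) t^-1 by exact: is_derive1_ln.
have dm := deriveR_powR m t0.
apply: is_derive_eq (deriveRD (deriveRD
  (deriveRM (dk A t) (deriveRD dl (deriveRN (deriveRM di (dk D^-1 t)))))
  (deriveRM (dk (B / (m - 1)) t) (deriveRD (deriveRM (dk (D `^ (m - 1)) t) di)
    (deriveRN (deriveRM dm (dk m^-1 t))))))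
  (deriveRM (dk eta t) di)) _.
rewrite /weight_tail.
move: (D `^ (m - 1)) (t `^ (m - 1)) (t `^ m) (D^-1) (t^-1) (B / (m - 1)) (ln t).
by move=> *; field.
Qed.

Lemma is_derive_weight_tail A B D m eta t : 1 < m -> 0 < t ->
  is_derive t 1 (weight_tail A B D m eta) (- weight A B m t).
Proof.
move=> m1 t0; have tn0 : t != 0 by rewrite gt_eqF.
have di := deriveR_id t; have dk := deriveR_cst (R := R).
have dV := deriveRV (f := fun x => x) tn0 di.
have dm := deriveR_powR (m - 1) t0.
apply: is_derive_eq (deriveRD (deriveRD
  (deriveRM (dk A t) (deriveRD dV (deriveRN (dk D^-1 t))))
  (deriveRM (dk (B / (m - 1)) t) (deriveRD (dk (D `^ (m - 1)) t) (deriveRN dm))))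
  (dk eta t)) _.
rewrite /weight (_ : 2 - m = - (m - 1 - 1)); last by ring.
rewrite powRN invrK.
move: (t `^ (m - 1 - 1)) (t `^ (m - 1)) (D `^ (m - 1)) D^-1 => x y z D'.
by field; rewrite tn0 subr_eq0 gt_eqF.
Qed.

Lemma continuous_weight A B m t : 0 < t -> {for t, continuous (weight A B m)}.
Proof.
move=> t0; have tn0 : t != 0 by rewrite gt_eqF.
have di := deriveR_id t; have dk := deriveR_cst (R := R).
have d2 := deriveRM di di.
have dV := deriveRV (f := fun x => x * x) (mulf_neq0 tn0 tn0) d2.
have dm := deriveR_powR (2 - m) t0.
have dmV := deriveRV (f := fun x => x `^ (2 - m)) (lt0r_neq0 (powR_gt0 _ t0)) dm.
exact: deriveR_continuous (deriveRD (deriveRM (dk A t) dV) (deriveRM (dk B t) dmV)).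
Qed.

Lemma weight_ge0 A B m t : 0 <= A -> 0 <= B -> 0 <= weight A B m t.
Proof.
by move=> A0 B0; rewrite addr_ge0 ?divr_ge0 ?powR_ge0 ?sqr_ge0.
Qed.

Lemma weight_tail_ge A B D m eta t : 0 <= A -> 0 <= B -> 1 < m -> 0 < t <= D ->
  eta <= weight_tail A B D m eta t.
Proof.
move=> A0 B0 m1 /andP[t0 tD]; have D0 := lt_le_trans t0 tD.
rewrite /weight_tail lerDr addr_ge0//.
  by rewrite mulr_ge0// subr_ge0 lef_pV2.
rewrite mulr_ge0//; first by rewrite divr_ge0// subr_ge0 ltW.
by rewrite subr_ge0; apply: ge0_ler_powR; rewrite ?nnegrE ?subr_ge0 ?(ltW m1) ?(ltW t0) ?(ltW D0).
Qed.

(** The scaling t = s D reduces the bound to the case D = 1. *)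
Lemma weight_tail_le A B D m eta k t : 0 <= A -> 1 < m -> 0 < t <= D -> 0 <= eta ->
  (forall s, 0 < s <= 1 -> B / (m - 1) * (s - s `^ m) <= k - A + A * s) ->
  weight_tail A (B / D `^ m) D m eta t <= (k + eta * D) / t.
Proof.
move=> A0 m1 /andP[t0 tD] eta0 sB; have D0 := lt_le_trans t0 tD.
have := sB (t / D); rewrite divr_gt0// ler_pdivrMr// mul1r tD => /(_ isT).
set s := t / D; have tE : t = s * D by rewrite /s divfK// gt_eqF.
have s0 : 0 < s by rewrite divr_gt0.
have Dm : 0 < D `^ m := powR_gt0 _ D0.
rewrite ler_pdivlMr// /weight_tail.
have -> : t `^ (m - 1) = s `^ m * D `^ m / t.
  rewrite -powRM ?ltW// -tE powRB ?powRr1 ?(ltW t0)//.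
  by rewrite (gt_eqF t0) implybT.
have -> : D `^ (m - 1) = D `^ m / D.
  by rewrite powRB ?powRr1 ?(ltW D0)// (gt_eqF D0) implybT.
have -> : (A * (t^-1 - D^-1) + B / D `^ m / (m - 1) * (D `^ m / D - s `^ m * D `^ m / t) + eta) * t
  = A * (1 - s) + B / (m - 1) * (s - s `^ m) + eta * t.
  rewrite tE; field.
  by rewrite !gt_eqF// ?mulr_gt0// subr_gt0.
have : eta * t <= eta * D by rewrite ler_wpM2l.
by move: (B / (m - 1) * _) (eta * t) (eta * D) => x y z; lra.
Qed.

End weights.

(** * The inequality with the Bessel constant *)

Section integrals.
Context {R : realType} {n : nat}.
Notation V := 'rV[R]_n.
Notation mu := (@lebesgue_measure_rV R n).
Variables (Omega : set V) (f : V -> R).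

Lemma integral_extend0 (phi : V -> R) : Cc (extend0 Omega phi) ->
  (\int[mu]_(x in Omega) (phi x)%:E = (integ (extend0 Omega phi))%:E)%E.
Proof.
move=> cphi; rewrite integral_mkcond /integ /Rintegral fineK; last first.
  by apply: integrable_fin_num => //; exact: Cc_integrable.
apply: eq_integral => x _; rewrite patchE /extend0.
by case: asboolP => Ox; [rewrite mem_set|rewrite memNset].
Qed.

End integrals.

Section hardy_final.
Context {R : realType} {n : nat}.
Notation V := 'rV[R]_n.
Variables (Omega : set V) (f : V -> R).
Hypotheses (oO : open Omega) (cO : convex_set Omega).
Hypotheses (bO : boundary Omega !=set0) (fC : C1_compact Omega f).
Notation d := (dist (boundary Omega)).

Lemma convex_hardy (Phi G w : R -> R) (D0 D1 : R) :
  csupp Omega f !=set0 -> D0 < D1 -> (forall x, Omega x -> d x <= D0) ->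
  (forall t, 0 < t < D1 -> is_derive t 1 Phi (G t)) ->
  (forall t, 0 < t < D1 -> is_derive t 1 G (- w t)) ->
  (forall t, 0 < t < D1 -> 0 <= w t) ->
  (forall t, 0 < t < D1 -> 0 <= G t) ->
  (forall t, 0 < t < D1 -> {for t, continuous w}) ->
  integ (extend0 Omega (fun x => `|f x| * w (d x))) <=
  integ (extend0 Omega (fun x => enorm (grad f x) * G (d x))).
Proof.
move=> K0 D01 dD0 dPhi dG w0 G0 cw.
have [e e0 Ke] := support_margin oO bO fC K0.
have := hardy_clamped oO cO bO fC K0 D01 dD0 dPhi dG w0 G0 cw e0 Ke.
have cl x : csupp Omega f x -> clamp D0 D1 e (d x) = d x.
  move=> Kx; apply: clampE => //; rewrite dD0 ?andbT; last exact: csupp_sub fC _ Kx.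
  by have := Ke x Kx; lra.
congr (_ <= _); apply: (congr1 integ); apply/funext => x.
- have [Kx|nKx] := pselect (csupp Omega f x).
    have Ox := csupp_sub fC Kx.
    by rewrite cl// /abs_ext !extend0E.
  rewrite (abs_ext_out nKx) mul0r; have [Ox|Ox] := pselect (Omega x).
    by rewrite extend0E// (csupp_out Ox nKx) normr0 mul0r.
  by rewrite extend0_out.
- have [Kx|nKx] := pselect (csupp Omega f x).
    have Ox := csupp_sub fC Kx.
    by rewrite cl// /grad_norm_ext !extend0E.
  have [Ox|Ox] := pselect (Omega x); last by rewrite /grad_norm_ext !extend0_out// mul0r.
  by rewrite /grad_norm_ext !extend0E// (csupp_grad_out oO Ox nKx) enorm0 !mul0r.
Qed.

Lemma dist_mul_Cc (phi : V -> R) (q : R -> R) :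
  (forall x, Omega x -> {for x, continuous phi}) ->
  (forall x, Omega x -> ~ csupp Omega f x -> phi x = 0) ->
  (forall t, 0 < t -> {for t, continuous q}) ->
  Cc (extend0 Omega (fun x => phi x * q (d x))).
Proof.
move=> cphi phi0 cq; apply: (Cc_extend0 oO fC) => x Ox; last first.
  by move=> nK; rewrite phi0// mul0r.
apply: continuousM; first exact: cphi.
apply: continuous_comp; first exact: dist_continuous.
by apply: cq; exact: dist_gt0.
Qed.

End hardy_final.

Theorem theorem5 (R : realType) (n : nat) (Omega : set 'rV[R]_n)
    (f : 'rV[R]_n -> R) (m nu lam : R) :
  let mu := @lebesgue_measure_rV R n in
  let d := fun x => fine (delta Omega x) in
  let d0 := fine (inradius Omega) in
  let c := bessel_c lam nu m in
  open Omega -> convex_set Omega -> (inradius Omega < +oo)%E ->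
  1 < m ->
  C1_compact Omega f ->
  mu.-integrable Omega (fun x => (enorm (grad f x) / d x)%:E) ->
  0 < nu <= 1 / m ->
  0 <= lam < (1 + nu * m) / 2 ->
  (((1 - nu ^+ 2 * m ^+ 2) / 4)%:E *
     \int[mu]_(x in Omega) (`|f x| / d x ^+ 2)%:E +
   ((c ^+ 2 + (m - 1) * (lam - lam ^+ 2)) / d0 `^ m)%:E *
     \int[mu]_(x in Omega) (`|f x| / d x `^ (2 - m))%:E
   <= ((1 + nu * m) / 2 - lam ^+ 2)%:E *
        \int[mu]_(x in Omega) (enorm (grad f x) / d x)%:E)%E.
Proof.
move=> mu d d0 c oO cO rO m1 fC _ /andP[nu0 num1] /andP[l0 lL].
have [K0|K0] := pselect (csupp Omega f !=set0); last first.
  have nK x : ~ csupp Omega f x by move=> Kx; apply: K0; exists x.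
  rewrite !integral0_eq ?mule0 ?adde0//.
  - by move=> x Ox; rewrite (csupp_grad_out oO Ox (nK x)) enorm0 mul0r.
  - by move=> x Ox; rewrite (csupp_out Ox (nK x)) normr0 mul0r.
  - by move=> x Ox; rewrite (csupp_out Ox (nK x)) normr0 mul0r.
have [x0 Kx0] := K0; have Ox0 := csupp_sub fC Kx0.
have dr x : Omega x -> (delta Omega x <= inradius Omega)%E.
  by move=> Ox; apply: ereal_sup_ubound; exists x.
have bO : boundary Omega !=set0.
  apply/set0P/negP => /eqP b0; have := le_lt_trans (dr x0 Ox0) rO.
  by rewrite /delta b0 image_set0 ereal_inf0 ltxx.
have dfin x : delta Omega x \is a fin_num := dist_fin x bO.
have rfin : inradius Omega \is a fin_num.
  rewrite fin_real// rO andbT (lt_le_trans _ (dr x0 Ox0))//.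
  by have /fin_numPlt/andP[] := dfin x0.
have dd0 x : Omega x -> d x <= d0.
  by move=> Ox; rewrite /d /d0 fine_le//; exact: dr.
have d_gt0 x : Omega x -> 0 < d x by exact: dist_gt0.
have d00 : 0 < d0 := lt_le_trans (d_gt0 x0 Ox0) (dd0 x0 Ox0).
have m0 : 0 < m := lt_trans ltr01 m1.
have num : nu * m <= 1 by move: num1; rewrite ler_pdivlMr.
pose L := (1 + nu * m) / 2; pose k := L - lam ^+ 2.
pose A := (1 - nu ^+ 2 * m ^+ 2) / 4; pose B := c ^+ 2 + (m - 1) * (lam - lam ^+ 2).
rewrite -/A -/B -/L -/k; rewrite -/L in lL.
have num0 : 0 < nu * m by rewrite mulr_gt0.
have L1 : L <= 1 by rewrite /L; lra.
have L0 : 0 <= L by rewrite /L; lra.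
have AE : A = L - L ^+ 2 by rewrite /A /L; field.
have A0 : 0 <= A by rewrite AE; nra.
have B0 : 0 <= B.
  apply: addr_ge0; first exact: sqr_ge0.
  by apply: mulr_ge0; [lra|nra].
have B'0 : 0 <= B / d0 `^ m by rewrite divr_ge0 ?powR_ge0.
have cf x : Omega x -> {for x, continuous (fun x => `|f x|)}.
  move=> Ox; have [df _ _] := fC; apply: continuous_comp; last exact: norm_continuous.
  exact/differentiable_continuous/df.
have f0 x : Omega x -> ~ csupp Omega f x -> `|f x| = 0.
  by move=> Ox nK; rewrite (csupp_out Ox nK) normr0.
have cg x : Omega x -> {for x, continuous (fun x => enorm (grad f x))}.
  move=> Ox; have [_ cg _] := fC; apply: continuous_comp; last exact: enorm_continuous.
  exact: cg.
have g0 x : Omega x -> ~ csupp Omega f x -> enorm (grad f x) = 0.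
  by move=> Ox nK; rewrite (csupp_grad_out oO Ox nK) enorm0.
have c2 (t : R) : 0 < t -> {for t, continuous (fun t : R => (t ^+ 2)^-1)}.
  move=> t0; apply: continuousV; first by rewrite expf_neq0// gt_eqF.
  exact: exprn_continuous.
have cm (t : R) : 0 < t -> {for t, continuous (fun t : R => (t `^ (2 - m))^-1)}.
  move=> t0; apply: continuousV; first by rewrite gt_eqF// powR_gt0.
  exact: continuous_powR_pos.
have c1 (t : R) : 0 < t -> {for t, continuous (fun t : R => t^-1)}.
  by move=> t0; apply: continuousV; [rewrite gt_eqF|exact: cvg_id].
have C1 := dist_mul_Cc oO bO fC cf f0 c2.
have C2 := dist_mul_Cc oO bO fC cf f0 cm.
have C3 := dist_mul_Cc oO bO fC cg g0 c1.
rewrite (integral_extend0 C1) (integral_extend0 C2) (integral_extend0 C3).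
rewrite -!EFinM -EFinD lee_fin.
pose W := weight A (B / d0 `^ m) m.
have -> : A * integ (extend0 Omega (fun x => `|f x| * (dist (boundary Omega) x ^+ 2)^-1)) +
   B / d0 `^ m * integ (extend0 Omega (fun x => `|f x| * (dist (boundary Omega) x `^ (2 - m))^-1)) =
   integ (extend0 Omega (fun x => `|f x| * W (dist (boundary Omega) x))).
  rewrite -(integZ A C1) -(integZ (B / d0 `^ m) C2) -(integD (Cc_scale _ C1) (Cc_scale _ C2)).
  apply: (congr1 integ); apply/funext => x; rewrite /extend0; case: asboolP => _; last by rewrite !mulr0 addr0.
  by rewrite /W /weight; ring.
set I3 := (X in _ <= _ * X).
suff key eta : 0 < eta -> integ (extend0 Omega (fun x => `|f x| * W (dist (boundary Omega) x))) <=
    (k + eta * d0) * I3.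
  apply/ler_addgt0Pr => z z0.
  have M1 : 0 < d0 * `|I3| + 1 by rewrite ltr_wpDl// mulr_ge0// ltW.
  apply: le_trans (key (z / (d0 * `|I3| + 1)) (divr_gt0 z0 M1)) _.
  rewrite [leLHS](_ : _ = k * I3 + z * (d0 * I3) / (d0 * `|I3| + 1)); last by ring.
  rewrite lerD2l ler_pdivrMr// ler_pM2l//.
  by apply: (@le_trans _ _ (d0 * `|I3|)); [rewrite ler_pM2l// ler_norm|rewrite lerDl].
move=> eta0.
pose G := weight_tail A (B / d0 `^ m) d0 m eta.
have dG (t : R) : 0 < t -> is_derive t 1 G (- W t) by exact: is_derive_weight_tail.
have cG (t : R) : 0 < t -> {for t, continuous G} by move=> t0; exact: deriveR_continuous (dG t t0).
(* G (d0) >= eta > 0, so that G is still nonnegative slightly beyond d0. *)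
have [r r0 rP] : exists2 r, 0 < r & forall t, `|d0 - t| < r -> 0 <= G t.
  have /cvgrPdist_lt/(_ _ eta0)/nbhs_normP[r /= r0 rP] := cG d0 d00.
  exists r => // t /rP /=; rewrite ltr_norml => /andP[_].
  have : eta <= G d0 by apply: weight_tail_ge => //; rewrite d00 lexx.
  by lra.
have Gge t : 0 < t < d0 + r -> 0 <= G t.
  move=> /andP[t0 tr]; have [td|td] := leP t d0.
    by apply: le_trans (ltW eta0) _; apply: weight_tail_ge => //; rewrite t0.
  by apply: rP; rewrite ltr_norml; apply/andP; split; lra.
apply: (@le_trans _ _ (integ (extend0 Omega (fun x => enorm (grad f x) * G (dist (boundary Omega) x))))).
  have D01 : d0 < d0 + r by rewrite ltrDl.
  have dP (t : R) : 0 < t < d0 + r ->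
      is_derive t 1 (weight_potential A (B / d0 `^ m) d0 m eta) (G t).
    by move=> /andP[t0 _]; exact: is_derive_weight_potential.
  have dG' (t : R) : 0 < t < d0 + r -> is_derive t 1 G (- W t) by move=> /andP[t0 _]; exact: dG.
  have W0 t : 0 < t < d0 + r -> 0 <= W t by move=> _; exact: weight_ge0.
  have cW (t : R) : 0 < t < d0 + r -> {for t, continuous W}.
    by move=> /andP[t0 _]; exact: continuous_weight.
  exact: (convex_hardy oO cO bO fC K0 D01 dd0 dP dG' W0 Gge cW).
have C4 := dist_mul_Cc oO bO fC cg g0 cG.
rewrite -(integZ (k + eta * d0) C3); apply: (le_integ C4 (Cc_scale _ C3)) => x.
rewrite /extend0; case: asboolP => Ox; last by rewrite mulr0.
rewrite mulrCA ler_wpM2l ?enorm_ge0//.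
apply: weight_tail_le => //; [by rewrite d_gt0//= dd0|exact: ltW|].
move=> s s01; have := bessel_c_bound m1 nu0 num (introT andP (conj l0 lL)) s01.
rewrite -/L -/c /B AE /k.
have -> : (c ^+ 2 + (m - 1) * (lam - lam ^+ 2)) / (m - 1) = c ^+ 2 / (m - 1) + lam - lam ^+ 2.
  by field; rewrite subr_eq0 gt_eqF.
by move: (_ * (s - _)) => y; lra.
Qed.
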